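(* Let $n,d\ge 1$ be integers, let $k>0$ be real, and let $C\subseteq\mathbb{R}^{n+d}$ be a convex body such that $\mathrm{proj}_{\mathbb{R}^n}(C)$ contains a Euclidean ball of radius $k$. Let $S=C\cap(\mathbb{Z}^n\times\mathbb{R}^d)$, and assume $S\neq\emptyset$. Then there is a point $\mathbf{x}\in S$ such that for every halfspace $H\subset\mathbb{R}^{n+d}$ that contains $\mathbf{x}$, $$\mathcal{H}_d(S\cap H)\ \ge\ \left(\frac1e-32\,\frac{d\,n^{3/4}}{k^{1/2}}\right)\mathcal{H}_d(S).$$ In particular, there exists a universal constant $\alpha>0$ (independent of $n,d,k,C$) such that if $k\ge\alpha d^2n^{3/2}$, then $$\mathcal{F}(S)\ \ge\ \frac{1}{2^n}\left(\frac{d}{d+1}\right)^d .$$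
   Context: A convex body is a compact convex set with nonempty interior. $\mathbb{R}^{n+d}$ is identified with $\mathbb{R}^n\times\mathbb{R}^d$ and $\mathrm{proj}_{\mathbb{R}^n}$ is the orthogonal projection onto the first $n$ coordinates. $\mathcal{H}_r$ is the $r$-dimensional Hausdorff measure, normalized so that for integer $r$ it coincides with $r$-dimensional Lebesgue measure on $r$-dimensional affine subspaces; so for $A\subseteq S$, $\mathcal{H}_d(A)=\sum_{z\in\mathbb{Z}^n}\mathrm{vol}_d(A\cap(\{z\}\times\mathbb{R}^d))$. Halfspaces are closed: $H(u,x)=\{y: u^\top(y-x)\ge 0\}$ with $u\neq 0$ (this one has $x$ on its boundary). For $K\subseteq\mathbb{R}^p$ with Hausdorff dimension $q=\dim K$, the Oertel radius of $K$ is $$\mathcal{F}(K)=\sup_{x\in K}\ \inf_{u\in\mathbb{R}^p\setminus\{0\}}\frac{\mathcal{H}_q(H(u,x)\cap K)}{\mathcal{H}_q(K)}.$$ *)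

(* Defs.v *)
From mathcomp Require Import all_boot all_order all_algebra.
From mathcomp Require Import all_classical all_reals all_analysis.
Set Implicit Arguments.
Unset Strict Implicit.
Unset Printing Implicit Defensive.
Import Order.TTheory GRing.Theory Num.Theory.
Import numFieldNormedType.Exports.
Local Open Scope classical_set_scope.
Local Open Scope ring_scope.

Section Euclidean.
Context {R : realType} {p : nat}.
Implicit Types (u x y z : 'rV[R]_p) (A K U : set 'rV[R]_p).

Definition dotv x y : R := \sum_(i < p) x 0 i * y 0 i.

(* The library norm on 'rV[R]_p is the sup norm. It induces the Euclidean
   topology (so compact and interior are the usual notions), but metric notions
   need the Euclidean norm. *)
Definition enorm x : R := Num.sqrt (dotv x x).

Definition eball x (r : R) : set 'rV[R]_p := [set y | enorm (y - x) <= r].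

(* diam set0 = -oo. *)
Definition diam U : \bar R :=
  ereal_sup [set (enorm (x - y))%:E | x in U & y in U].

Definition convex_body A := [/\ compact A, convex_set A & A° !=set0].

Definition halfspace u z : set 'rV[R]_p := [set y | 0 <= dotv u (y - z)].

End Euclidean.

Section Hausdorff.
Context {R : realType}.

Definition Gamma (s : R) : R :=
  \int[lebesgue_measure]_(t in `]0, +oo[) (t `^ (s - 1) * expR (- t)).

(* For integer r, the volume of a Euclidean ball of diameter 1 in R^r; this
   factor makes H_r agree with r-dimensional Lebesgue measure. *)
Definition hausdorff_factor (r : R) : R :=
  pi `^ (r / 2) / (Gamma (r / 2 + 1) * 2 `^ r).

Context {p : nat}.
Implicit Types (r delta : R) (A K U : set 'rV[R]_p).

(* The empty set contributes 0 also for r = 0, whereas singletons contribute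
   0 `^ 0 = 1 there, so that H_0 counts points. *)
Definition diam_pow r U : \bar R :=
  if `[< U = set0 >] then 0%E else poweR (diam U) r.

Definition hausdorff_content r delta A : \bar R :=
  ereal_inf [set (\sum_(0 <= i <oo) diam_pow r (U i))%E |
    U in [set U : nat -> set 'rV[R]_p |
           A `<=` \bigcup_i U i /\ forall i, (diam (U i) <= delta%:E)%E]].

(* The supremum is the limit as delta tends to 0, by monotonicity. *)
Definition hausdorff r A : \bar R :=
  ((hausdorff_factor r)%:E *
   ereal_sup [set hausdorff_content r delta A | delta in [set d | (0 < d)%R]])%E.

Definition hausdorff_dim A : R := inf [set r : R | 0 <= r /\ hausdorff r A = 0%E].

(* The ratio is meaningful when 0 < H_q(K) < +oo; otherwise the conventions
   0^-1 = +oo, +oo^-1 = 0 and 0 * +oo = 0 of \bar R apply. *)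
Definition oertel_radius K : \bar R :=
  let q := hausdorff_dim K in
  ereal_sup [set
    ereal_inf [set (hausdorff q (halfspace u x `&` K) / hausdorff q K)%E |
                u in [set u | u != 0]] | x in K].

End Hausdorff.

(* Z^n x R^d *)
Definition mixed_integer (R : realType) (n d : nat) : set 'rV[R]_(n + d) :=
  [set x | forall i : 'I_n, lsubmx x 0 i \is a Num.int].

Arguments mixed_integer : clear implicits.

(* Main.v *)
Require Import Defs.
From mathcomp Require Import all_boot all_order all_algebra.
From mathcomp Require Import all_classical all_reals all_analysis.
From mathcomp Require Import measurable_realfun.
From mathcomp Require Import ring lra zify.
Set Implicit Arguments.
Unset Strict Implicit.
Unset Printing Implicit Defensive.
Import Order.TTheory GRing.Theory Num.Theory.
Import numFieldNormedType.Exports.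
Local Open Scope classical_set_scope.
Local Open Scope ring_scope.

(** Let [N = n + d], [delta = sqrt n / k], let [g] be (nearly) the barycenter of [C],
    and write [C_t] for the part of [C] where a linear form [u] is at least [t].
    Midpoint log-concavity of [t |-> vol C_t] (the multiplicative Brunn-Minkowski
    inequality) gives Grünbaum's bound [vol C_(u g) >= vol C / e], and slabs of
    relative width [eps] have volume [O(N eps) vol C].  Every
    [v] in a cube of side [1 / delta] is the projection of some [x' in C], and
    [(1 - delta) x + delta x'] stays in [C] for [x in C].  Moving [g] in this way
    yields a mixed-integer point [x] whose level [u x] differs from [u g] by at
    most [delta] times the width of [C].  Moving in this way the points over a unit
    cell of [R^n] to the integer point of that cell compares the sum of the volumes
    of the mixed-integer slices with the [N]-dimensional volume, in both directions
    up to a factor [(1 - delta)^(2 N)].  All losses are [O(N delta)], which is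
    [O(s^2)] for [s = d n^(3/4) / k^(1/2)], whereas the claim allows [32 s].

    Volume is the Hausdorff measure of full dimension, normalized on the unit
    cube: it is monotone, scales correctly, and is determined up to the boundary
    by counting grid cubes.  Brunn-Minkowski then reduces to the bound
    [#(A + B + {0,1}^p)^2 >= 4^p #A #B] for finite sets in [Z^p]. *)

(** * A discrete Prékopa-Leindler inequality *)

(** No measurability of sets enters. Hausdorff measure is used as an outer measure on arbitrary
    sets: subadditive, and additive only over sets at positive distance, which the definition by
    covers of small diameter yields directly. Adjacent closed cubes touch, so estimates from below
    are proved for slightly shrunk sets, and the factor [(1 - t) ^+ p] is removed by letting [t]
    tend to 0; a cube [box c r] inside the body is what makes such shrinking and the opposite
    fattening harmless. The barycenter is replaced by a mean of finitely many grid points and the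
    volume profile by caps at equidistant levels, at the price of an arbitrarily small loss, chosen
    to be [N delta]. The total loss is [17 N delta]: 1 for that choice, 12 for a slab of relative
    width [3 delta], 4 for comparing slices with volume twice. Since [N <= 2 d^2 n], it is at most
    [34 s^2], which is below [32 s] as soon as [s <= 1/32]; for larger [s] the claimed bound is
    negative. *)

Lemma card_sumset (B : nat) (A A' : {set 'I_B}) (C : {set 'I_(B + B)}) :
  A != finset.set0 -> A' != finset.set0 ->
  (forall i j (c : 'I_(B + B)), i \in A -> j \in A' ->
     (c == i + j :> nat)%N || (c == (i + j).+1 :> nat)%N -> c \in C) ->
  (#|A| + #|A'| <= #|C|)%N.
Proof.
move=> /finset.set0Pn[a0 a0A] /finset.set0Pn[b0 b0A] AC.
case: (@arg_maxnP _ a0 (mem A) (fun i : 'I_B => i : nat) a0A) => a aA amax.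
case: (@arg_minnP _ b0 (mem A') (fun i : 'I_B => i : nat) b0A) => b bA bmin.
have lt1 (i j : 'I_B) : (i + j < B + B)%N by have := ltn_ord i; have := ltn_ord j; lia.
have lt2 (i j : 'I_B) : ((i + j).+1 < B + B)%N by have := ltn_ord i; have := ltn_ord j; lia.
(* The translates [A + min A'] and [max A + A' + 1] are disjoint: the first ends at
   [max A + min A'], the second begins one higher. *)
pose f i := Ordinal (lt1 i b); pose g j := Ordinal (lt2 a j).
have finj : injective f by move=> i j /(congr1 val) /= ?; apply: val_inj => /=; lia.
have ginj : injective g by move=> i j /(congr1 val) /= ?; apply: val_inj => /=; lia.
rewrite -(card_imset _ finj) -(card_imset _ ginj) -cardsUI.
have -> : f @: A :&: g @: A' = finset.set0.
  apply/setP => c; rewrite !inE; apply/negP => /andP[/imsetP[i iA ->] /imsetP[j jA]].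
  by move=> /(congr1 val) /=; have := amax i iA; have := bmin j jA; rewrite /=; lia.
rewrite cards0 addn0; apply: subset_leq_card; apply/fintype.subsetP => c; rewrite inE.
case/orP => /imsetP[i iA ->]; first by apply: (AC i b) => //; rewrite /= eqxx.
by apply: (AC a i) => //; rewrite /= eqxx orbT.
Qed.

Lemma count_le_real (R : realType) (T : nat) (x : R) : 0 <= x ->
  (\sum_(t < T) (t.+1%:R <= x)%R)%:R <= x.
Proof.
move=> x0; elim: T => [|T IH]; first by rewrite big_ord0.
rewrite big_ord_recr /= natrD; have [h|_] := boolP (T.+1%:R <= x); last by rewrite addr0.
apply: le_trans h; rewrite -natr1 lerD2r ler_nat.
by rewrite -[leqRHS]card_ord -sum1_card leq_sum // => i _; case: (_ <= _).
Qed.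


(* Normalizing the maxima of [f] and [g] makes all the level sets of [f] and
   [g] nonempty simultaneously, and these add up by [card_sumset]. *)
Lemma prekopa_leindler_1d (R : realType) (B : nat) (f g : nat -> nat) (H : nat -> R) :
  (forall i, 0 <= H i) ->
  (forall i j, (f i * g j)%:R <= H (i + j)%N ^+ 2) ->
  (forall i j, (f i * g j)%:R <= H (i + j).+1 ^+ 2) ->
  4 * ((\sum_(i < B) f i) * (\sum_(j < B) g j))%:R <= (\sum_(k < B + B) H k) ^+ 2.
Proof.
move=> H0 Hf Hg.
set F := (\max_(i < B) f i)%N; set G := (\max_(i < B) g i)%N.
have [F0|Fpos] := posnP F.
  rewrite big1 ?mul0n ?mulr0 ?sqr_ge0// => i _.
  by apply/eqP; rewrite -leqn0 -F0; exact: (@leq_bigmax _ (fun i : 'I_B => f i)).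
have [G0|Gpos] := posnP G.
  rewrite [X in (_ * X)%N]big1 ?muln0 ?mulr0 ?sqr_ge0// => i _.
  by apply/eqP; rewrite -leqn0 -G0; exact: (@leq_bigmax _ (fun i : 'I_B => g i)).
set T := (F * G)%N.
have Tpos : (0 < T)%N by rewrite muln_gt0 Fpos.
pose A t := [set i : 'I_B | (t < f i * G)%N]%SET.
pose A' t := [set i : 'I_B | (t < g i * F)%N]%SET.
(* If [t < f i * G] and [t < g j * F], then [t.+1 ^ 2] is at most [f i * g j * T]. This is the
   threshold that puts [i + j] and its successor in [C t]. *)
pose C t := [set k : 'I_(B + B) | t.+1%:R <= H k * Num.sqrt T%:R]%SET.
have ord_max_ex (h : nat -> nat) : (0 < \max_(i < B) h i)%N ->
    exists i : 'I_B, h i = (\max_(i < B) h i)%N.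
  case: (posnP B) => [B0|Bp _]; first by rewrite big1// => -[i i0]; exfalso; move: i0; rewrite B0.
  have [|i hi] := @bigop.eq_bigmax _ (fun i : 'I_B => h i); first by rewrite card_ord.
  by exists i; rewrite hi.
have key (t : nat) : (t < T)%N -> (#|A t| + #|A' t| <= #|C t|)%N.
  move=> tT; apply: card_sumset.
  - have [i fi] := ord_max_ex _ Fpos.
    by apply/finset.set0Pn; exists i; rewrite inE fi.
  - have [i fi] := ord_max_ex _ Gpos.
    by apply/finset.set0Pn; exists i; rewrite inE fi mulnC.
  - move=> i j c; rewrite !inE => ti tj ec.
    have Hc : (f i * g j)%:R <= H c ^+ 2.
      by case/orP: ec => /eqP ->; [exact: Hf|exact: Hg].
    rewrite -(@ler_pXn2r _ 2) ?nnegrE ?mulr_ge0 ?sqrtr_ge0//.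
    rewrite exprMn sqr_sqrtr// (@le_trans _ _ ((f i * g j)%:R * T%:R))//; last by rewrite ler_wpM2r.
    by rewrite -natrX -natrM ler_nat; nia.
have sumA (h : nat -> nat) (K : nat) : (forall i : 'I_B, (h i * K <= T)%N) ->
   (\sum_(t < T) #|[set i : 'I_B | (t < h i * K)%N]%SET| = (\sum_(i < B) h i) * K)%N.
  move=> hK; under eq_bigr do rewrite -sum1_card big_mkcond /=.
  rewrite exchange_big big_distrl /=; apply: eq_bigr => i _.
  under eq_bigr do rewrite inE.
  rewrite -big_mkcond /= sum1dep_card.
  have winj : injective (widen_ord (hK i)) by move=> x y /(congr1 val) /= e; exact: val_inj.
  rewrite -[RHS]card_ord -(card_imset _ winj).
  apply: eq_card => t; rewrite !inE; apply/idP/imsetP => [ti|[x _ ->]]; last by rewrite /=.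
  by exists (Ordinal ti) => //; exact: val_inj.
have le1 : ((\sum_(i < B) f i) * G + (\sum_(i < B) g i) * F)%N%:R <=
    \sum_(k < B + B) H k * Num.sqrt T%:R.
  rewrite -sumA; last first.
    by move=> i; apply: leq_mul => //; exact: (@leq_bigmax _ (fun i : 'I_B => f i)).
  rewrite -sumA; last first.
    by move=> i; rewrite mulnC; apply: leq_mul => //; exact: (@leq_bigmax _ (fun i : 'I_B => g i)).
  rewrite -big_split /=.
  apply: (@le_trans _ _ (\sum_(t < T) #|C t|)%:R).
    by rewrite ler_nat; apply: leq_sum => t _; exact: key.
  under [X in X%:R <= _]eq_bigr do rewrite -sum1_card big_mkcond /=.
  rewrite exchange_big natr_sum /=; apply: ler_sum => k _.
  under eq_bigr do rewrite inE.
  rewrite (eq_bigr (fun t : 'I_T => ((t.+1%:R <= H k * Num.sqrt T%:R)%R : nat))).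
    by apply: count_le_real; rewrite mulr_ge0 ?sqrtr_ge0.
  by move=> t _; case: (_ <= _).
move: le1; rewrite -mulr_suml; set h := \sum_(_ < _) H _.
set a := (\sum_(i < B) f i)%N; set b := (\sum_(i < B) g i)%N => le1.
have h0 : 0 <= h by apply: sumr_ge0.
have : (a * G + b * F)%N%:R ^+ 2 <= h ^+ 2 * T%:R :> R.
  by rewrite -[X in _ * X]sqr_sqrtr// -exprMn ler_pXn2r ?nnegrE// mulr_ge0 ?sqrtr_ge0.
(* AM-GM for [a * G] and [b * F] turns the sum of the two layer counts into the product [a * b]; the
   factor [T] cancels. *)
move=> le2; rewrite -(@ler_pM2r _ T%:R) ?ltr0n//; apply: le_trans le2.
rewrite -natrX -!natrM ler_nat /T.
have -> : (4 * (a * b) * (F * G) = 4 * ((a * G) * (b * F)))%N.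
  by rewrite -mulnA; congr muln; rewrite (mulnACA a G) (mulnC G).
exact: (nat_AGM2 _ _).1.
Qed.

Lemma sum_row_mx (V : nmodType) (B n d : nat) (F : 'rV['I_B]_(n + d) -> V) :
  \sum_x F x = \sum_(a : 'rV['I_B]_n) \sum_(b : 'rV['I_B]_d) F (row_mx a b).
Proof.
rewrite pair_bigA /= (reindex (fun p : 'rV['I_B]_n * 'rV['I_B]_d => row_mx p.1 p.2)) //=.
exists (fun x => (lsubmx x, rsubmx x)) => [[a b] _|x _] /=; last by rewrite hsubmxK.
by rewrite row_mxKl row_mxKr.
Qed.

Lemma sum_rV0 (V : nmodType) (T : finType) (F : 'rV[T]_0 -> V) (x0 : 'rV[T]_0) :
  \sum_x F x = F x0.
Proof. by rewrite (bigD1 x0) //= big1 ?addr0// => x /eqP []; apply/matrixP => i []. Qed.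

Lemma sum_rV1 (V : nmodType) (T : finType) (F : 'rV[T]_1 -> V) :
  \sum_x F x = \sum_(t : T) F (const_mx t).
Proof.
rewrite (reindex (fun t : T => const_mx t : 'rV[T]_1)) //=.
exists (fun x : 'rV[T]_1 => x 0 0) => [t _|x _]; first by rewrite mxE.
by apply/rowP => i; rewrite mxE !ord1.
Qed.

Definition natv (B p : nat) (x : 'rV['I_B]_p) : 'rV[nat]_p := map_mx val x.

(** Induction on the dimension: the sums over the remaining coordinates, that of [H] divided by
    [2 ^+ p], satisfy the one-dimensional hypotheses. The point [z] lives on a grid of half the
    mesh: the midpoints of two unit intervals at [x] and [y] fill exactly the two half-size
    intervals with indices [x + y] and [x + y + 1], and [4 ^+ p] accounts for the change of mesh. *)
Lemma prekopa_leindler_grid (R : realType) (B p : nat) (f g : 'rV[nat]_p -> nat)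
    (H : 'rV[nat]_p -> R) :
  (forall x, 0 <= H x) ->
  (forall x y z : 'rV[nat]_p,
     (forall i, z ord0 i = (x ord0 i + y ord0 i)%N \/ z ord0 i = (x ord0 i + y ord0 i).+1) ->
     (f x * g y)%:R <= H z ^+ 2) ->
  4 ^+ p * ((\sum_(x : 'rV['I_B]_p) f (natv x)) * (\sum_(x : 'rV['I_B]_p) g (natv x)))%:R
    <= (\sum_(z : 'rV['I_(B + B)]_p) H (natv z)) ^+ 2.
Proof.
elim: p f g H => [|p IH] f g H H0 Hfg.
  have e (T : finType) : 'rV[T]_0 by apply: (fun F : 'I_0 -> T => \row_i F i) => -[].
  rewrite !(sum_rV0 _ (e _)) expr0 mul1r; apply: Hfg.
  by move=> [].
pose f1 i := (\sum_(x : 'rV['I_B]_p) f (row_mx (const_mx i : 'rV_1) (natv x)))%N.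
pose g1 i := (\sum_(x : 'rV['I_B]_p) g (row_mx (const_mx i : 'rV_1) (natv x)))%N.
pose H1 i := (\sum_(x : 'rV['I_(B + B)]_p) H (row_mx (const_mx i : 'rV_1) (natv x))) / 2 ^+ p.
have eqN (V : nmodType) (A : nat) (h : 'rV[nat]_(1 + p) -> V) :
    \sum_(x : 'rV['I_A]_(1 + p)) h (natv x) =
    \sum_(i < A) \sum_(x : 'rV['I_A]_p) h (row_mx (const_mx (i : nat) : 'rV_1) (natv x)).
  rewrite sum_row_mx sum_rV1; apply: eq_bigr => i _; apply: eq_bigr => x _.
  by rewrite /natv map_row_mx map_const_mx.
have H1_0 i : 0 <= H1 i by rewrite divr_ge0 ?exprn_ge0// sumr_ge0.
have e4 : (2 ^+ p) ^+ 2 = 4 ^+ p :> R by rewrite exprAC expr2 -natrM.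
have step i j k : (k = i + j \/ k = (i + j).+1)%N -> (f1 i * g1 j)%:R <= H1 k ^+ 2.
  move=> hk; rewrite expr_div_n e4 ler_pdivlMr ?exprn_gt0// mulrC.
  apply: (IH (fun x => f (row_mx (const_mx i : 'rV_1) x))
    (fun x => g (row_mx (const_mx j : 'rV_1) x))
    (fun x => H (row_mx (const_mx k : 'rV_1) x))) => // x y z hz; apply: Hfg => l.
  rewrite -[l](@splitK 1 p); case: (@fintype.split 1 p l) => l' /=.
    by rewrite !(@row_mxEl _ 1 1 p) !mxE.
  by rewrite !(@row_mxEr _ 1 1 p); exact: hz.
have := @prekopa_leindler_1d R B f1 g1 H1 H1_0
  (fun i j => step i j _ (or_introl erefl)) (fun i j => step i j _ (or_intror erefl)).
rewrite /f1 /g1 -!(eqN nat) -mulr_suml -(eqN R) expr_div_n e4.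
by rewrite ler_pdivlMr ?exprn_gt0// mulrAC -exprS.
Qed.

(** * Hausdorff measures *)
Section EnormTheory.
Context {R : realType} {p : nat}.
Implicit Types (x y : 'rV[R]_p) (U V : set 'rV[R]_p).

Lemma dotv_ge0 x : 0 <= dotv x x.
Proof. by apply: sumr_ge0 => i _; rewrite -expr2 sqr_ge0. Qed.

Lemma enorm_ge0 x : 0 <= enorm x. Proof. exact: sqrtr_ge0. Qed.

Lemma enorm0 : enorm (0 : 'rV[R]_p) = 0.
Proof. by rewrite /enorm /dotv big1 ?sqrtr0// => i _; rewrite mxE mul0r. Qed.

Lemma enormZ (c : R) x : enorm (c *: x) = `|c| * enorm x.
Proof.
rewrite /enorm -sqrtr_sqr -sqrtrM ?sqr_ge0//; congr Num.sqrt.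
by rewrite /dotv mulr_sumr; apply: eq_bigr => i _; rewrite !mxE; ring.
Qed.

Lemma coord_le_enorm x i : `|x 0 i| <= enorm x.
Proof.
rewrite /enorm -sqrtr_sqr; apply: ler_wsqrtr.
rewrite /dotv (bigD1 i) //= -expr2 lerDl.
by apply: sumr_ge0 => j _; rewrite -expr2 sqr_ge0.
Qed.

Lemma enorm_le_coord x (c : R) : 0 <= c -> (forall i, `|x 0 i| <= c) ->
  enorm x <= Num.sqrt p%:R * c.
Proof.
move=> c0 xc.
rewrite -[X in _ * X]ger0_norm// -sqrtr_sqr -sqrtrM ?ler0n//.
apply: ler_wsqrtr; rewrite /dotv (@le_trans _ _ (\sum_(i < p) c ^+ 2))//.
  apply: ler_sum => i _; rewrite -expr2 -real_normK ?num_real//.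
  by rewrite ler_pXn2r ?nnegrE.
by rewrite sumr_const card_ord mulr_natl.
Qed.

Lemma diam_ubound U x y : U x -> U y -> ((enorm (x - y))%:E <= diam U)%E.
Proof. by move=> Ux Uy; apply: ereal_sup_ubound; exists x => //; exists y. Qed.

Lemma diam_le U (c : \bar R) :
  (forall x y, U x -> U y -> ((enorm (x - y))%:E <= c)%E) -> (diam U <= c)%E.
Proof. by move=> Uc; apply: ge_ereal_sup => _ [x Ux [y Uy <-]]; exact: Uc. Qed.

Lemma diam_ge0 U : U !=set0 -> (0 <= diam U)%E.
Proof.
by move=> [x Ux]; apply: le_trans (diam_ubound Ux Ux); rewrite lee_fin enorm_ge0.
Qed.

Lemma diam_sub U V : U `<=` V -> (diam U <= diam V)%E.
Proof. by move=> UV; apply: diam_le => x y /UV Vx /UV Vy; exact: diam_ubound. Qed.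

Lemma diam_pow_ge0 r U : (0 <= diam_pow r U)%E.
Proof. by rewrite /diam_pow; case: ifP => // _; exact: poweR_ge0. Qed.

Lemma diam_pow0 r : diam_pow r (set0 : set 'rV[R]_p) = 0%E.
Proof. by rewrite /diam_pow; case: ifPn => // /asboolP; case. Qed.

Lemma diam_powE r U : U !=set0 -> diam_pow r U = poweR (diam U) r.
Proof. by move=> /set0P/eqP U0; rewrite /diam_pow; case: ifPn => // /asboolP. Qed.

Lemma diam_pow_sub r U V : 0 <= r -> U `<=` V -> (diam_pow r U <= diam_pow r V)%E.
Proof.
move=> r0 UV; have [->|/set0P U0] := eqVneq U set0; first by rewrite diam_pow0 diam_pow_ge0.
have V0 : V !=set0 by case: U0 => x /UV; exists x.
rewrite !diam_powE//; apply: gt0_ler_poweR => //; last exact: diam_sub.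
- by rewrite in_itv /= diam_ge0//= leey.
- by rewrite in_itv /= diam_ge0//= leey.
Qed.

End EnormTheory.

Lemma diam_image_le (R : realType) (p q : nat) (U : set 'rV[R]_p)
    (f : 'rV[R]_p -> 'rV[R]_q) (c : R) : 0 <= c ->
  (forall x y, U x -> U y -> enorm (f x - f y) <= c * enorm (x - y)) ->
  (diam (f @` U) <= c%:E * diam U)%E.
Proof.
move=> c0 fc; apply: diam_le => _ _ [x Ux <-] [y Uy <-].
apply: (@le_trans _ _ (c * enorm (x - y))%:E); first by rewrite lee_fin fc.
by rewrite EFinM; apply: lee_wpmul2l => //; exact: diam_ubound.
Qed.

Lemma diam_pow_image_le (R : realType) (p q : nat) (U : set 'rV[R]_p)
    (f : 'rV[R]_p -> 'rV[R]_q) (c r : R) : 0 <= c -> 0 <= r ->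
  (forall x y, U x -> U y -> enorm (f x - f y) <= c * enorm (x - y)) ->
  (diam_pow r (f @` U) <= (c `^ r)%:E * diam_pow r U)%E.
Proof.
move=> c0 r0 fc; have [->|/set0P U0] := eqVneq U set0.
  by rewrite image_set0 !diam_pow0 mule0.
have fU0 : (f @` U) !=set0 by case: U0 => x; exists (f x), x.
rewrite !diam_powE// -poweR_EFin -poweRM ?lee_fin ?diam_ge0//.
have := diam_image_le c0 fc; have := diam_ge0 fU0; have := diam_ge0 U0 => d0 d1 d2.
apply: gt0_ler_poweR => //; rewrite in_itv /= leey andbT//.
exact: le_trans d2.
Qed.

Lemma ereal_inf_add_ge (R : realType) (S T : set (\bar R)) (x : \bar R) :
  (forall a, S a -> (0 <= a)%E) -> (forall b, T b -> (0 <= b)%E) ->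
  (forall a b, S a -> T b -> (x <= a + b)%E) -> (x <= ereal_inf S + ereal_inf T)%E.
Proof.
move=> S0 T0 xST.
have iS : (0 <= ereal_inf S)%E by apply: le_ereal_inf_tmp.
have iT : (0 <= ereal_inf T)%E by apply: le_ereal_inf_tmp.
have [Sf|] := boolP (ereal_inf S \is a fin_num); last first.
  rewrite ge0_fin_numE// -leNgt leye_eq => /eqP ->.
  by rewrite addye ?leey// gt_eqF// (lt_le_trans _ iT).
have [Tf|] := boolP (ereal_inf T \is a fin_num); last first.
  rewrite ge0_fin_numE// -leNgt leye_eq => /eqP ->.
  by rewrite addey ?leey// gt_eqF// (lt_le_trans _ iS).
apply/lee_addgt0Pr => e e0.
have [a Sa ltA] := lb_ereal_inf_adherent (divr_gt0 e0 (ltr0Sn R 1)) Sf.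
have [b Tb ltB] := lb_ereal_inf_adherent (divr_gt0 e0 (ltr0Sn R 1)) Tf.
apply: le_trans (xST _ _ Sa Tb) _; apply: le_trans (leeD (ltW ltA) (ltW ltB)) _.
by rewrite addeACA -EFinD -splitr.
Qed.

Lemma ereal_sup_add_le (R : realType) (S T : set (\bar R)) (x : \bar R) :
  S !=set0 -> T !=set0 ->
  (forall a, S a -> (0 <= a)%E) -> (forall b, T b -> (0 <= b)%E) ->
  (forall a b, S a -> T b -> (a + b <= x)%E) -> (ereal_sup S + ereal_sup T <= x)%E.
Proof.
move=> [a0 Sa0] [b0 Tb0] S0 T0 xST.
have [xf|] := boolP (x \is a fin_num); last first.
  rewrite ge0_fin_numE -?leNgt ?leye_eq; first by move=> /eqP ->; rewrite leey.
  by apply: le_trans (xST _ _ Sa0 Tb0); apply: adde_ge0; [exact: S0|exact: T0].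
have Sx : (ereal_sup S <= x)%E.
  by apply: ge_ereal_sup => a Sa; apply: le_trans (xST _ _ Sa Tb0); rewrite leeDl ?T0.
have Tx : (ereal_sup T <= x)%E.
  by apply: ge_ereal_sup => b Tb; apply: le_trans (xST _ _ Sa0 Tb); rewrite leeDr ?S0.
have fin S' c : S' c -> (0 <= c)%E -> (ereal_sup S' <= x)%E -> ereal_sup S' \is a fin_num.
  move=> S'c c0 S'x; rewrite ge0_fin_numE ?(le_lt_trans S'x) ?ltey_eq ?xf//.
  by apply: le_trans c0 _; exact: ereal_sup_ubound.
apply/lee_addgt0Pr => e e0.
have [a Sa ltA] := ub_ereal_sup_adherent (divr_gt0 e0 (ltr0Sn R 1)) (fin _ _ Sa0 (S0 _ Sa0) Sx).
have [b Tb ltB] := ub_ereal_sup_adherent (divr_gt0 e0 (ltr0Sn R 1)) (fin _ _ Tb0 (T0 _ Tb0) Tx).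
move: ltA ltB; rewrite !lteBlDr// => /ltW ltA /ltW ltB.
apply: le_trans (leeD ltA ltB) _.
by rewrite addeACA -EFinD -splitr leeD2r// xST.
Qed.

Section PreHausdorff.
Context {R : realType}.

(* The Hausdorff measure without its normalizing factor. *)
Definition prehausdorff {p : nat} (r : R) (A : set 'rV[R]_p) : \bar R :=
  ereal_sup [set hausdorff_content r delta A | delta in [set d | 0 < d]].

Section FixedDimension.
Context {p : nat}.
Implicit Types (r e delta : R) (A B U : set 'rV[R]_p).

Lemma hausdorff_content_lb r delta A (x : \bar R) :
  (forall U : nat -> set 'rV[R]_p, A `<=` \bigcup_i U i ->
     (forall i, (diam (U i) <= delta%:E)%E) ->
     (x <= \sum_(0 <= i <oo) diam_pow r (U i))%E) ->
  (x <= hausdorff_content r delta A)%E.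
Proof. by move=> h; apply: le_ereal_inf_tmp => _ [U [? ?] <-]; exact: h. Qed.

Lemma hausdorff_content_ub r delta A (U : nat -> set 'rV[R]_p) :
  A `<=` \bigcup_i U i -> (forall i, (diam (U i) <= delta%:E)%E) ->
  (hausdorff_content r delta A <= \sum_(0 <= i <oo) diam_pow r (U i))%E.
Proof. by move=> AU Ud; apply: ereal_inf_lbound; exists U. Qed.

Lemma diam_pow_series_ge0 r (U : nat -> set 'rV[R]_p) :
  (0 <= \sum_(0 <= i <oo) diam_pow r (U i))%E.
Proof. by apply: nneseries_ge0 => n _ _; exact: diam_pow_ge0. Qed.

Lemma hausdorff_content_ge0 r delta A : (0 <= hausdorff_content r delta A)%E.
Proof. by apply: hausdorff_content_lb => U _ _; exact: diam_pow_series_ge0. Qed.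

Lemma hausdorff_content_sub r delta A B : A `<=` B ->
  (hausdorff_content r delta A <= hausdorff_content r delta B)%E.
Proof.
move=> AB; apply: hausdorff_content_lb => U BU Ud; apply: hausdorff_content_ub => //.
exact: subset_trans BU.
Qed.

Lemma hausdorff_content_anti r delta delta' A : delta <= delta' ->
  (hausdorff_content r delta' A <= hausdorff_content r delta A)%E.
Proof.
move=> dd; apply: hausdorff_content_lb => U BU Ud; apply: hausdorff_content_ub => //.
by move=> i; rewrite (le_trans (Ud i))// lee_fin.
Qed.

Lemma content_le_prehausdorff r delta A : 0 < delta ->
  (hausdorff_content r delta A <= prehausdorff r A)%E.
Proof. by move=> d0; apply: ereal_sup_ubound; exists delta. Qed.

Lemma prehausdorff_le r A (x : \bar R) :
  (forall delta, 0 < delta -> (hausdorff_content r delta A <= x)%E) ->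
  (prehausdorff r A <= x)%E.
Proof. by move=> h; apply: ge_ereal_sup => _ [d d0 <-]; exact: h. Qed.

Lemma prehausdorff_ge0 r A : (0 <= prehausdorff r A)%E.
Proof. exact: le_trans (hausdorff_content_ge0 r 1 A) (content_le_prehausdorff _ _ ltr01). Qed.

Lemma prehausdorff_sub r A B : A `<=` B -> (prehausdorff r A <= prehausdorff r B)%E.
Proof.
move=> AB; apply: prehausdorff_le => d d0.
exact: le_trans (hausdorff_content_sub _ _ AB) (content_le_prehausdorff _ _ d0).
Qed.

Lemma hausdorff_content_diam r d A : (diam A <= d%:E)%E ->
  (hausdorff_content r d A <= diam_pow r A)%E.
Proof.
move=> Ad; pose U (i : nat) : set 'rV[R]_p := if i is 0%N then A else set0.
apply: le_trans (hausdorff_content_ub (U := U) _ _ _) _.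
- by move=> x Ax; exists 0%N.
- by case=> [//|i]; apply: diam_le.
rewrite nneseries_recl//; last by move=> *; exact: diam_pow_ge0.
rewrite eseries0 ?adde0// => -[//|i] _ _; exact: diam_pow0.
Qed.

Lemma hausdorff_content0 r d : hausdorff_content r d (set0 : set 'rV[R]_p) = 0%E.
Proof.
apply/eqP; rewrite eq_le hausdorff_content_ge0 andbT -(@diam_pow0 R p r).
by apply: hausdorff_content_diam; exact: diam_le.
Qed.

Lemma prehausdorff0 r : prehausdorff r (set0 : set 'rV[R]_p) = 0%E.
Proof.
apply/eqP; rewrite eq_le prehausdorff_ge0 andbT; apply: prehausdorff_le => d d0.
by rewrite hausdorff_content0.
Qed.

Lemma hausdorff_contentU r d A B :
  (hausdorff_content r d (A `|` B) <= hausdorff_content r d A + hausdorff_content r d B)%E.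
Proof.
apply: ereal_inf_add_ge; [by move=> _ [U _ <-]; exact: diam_pow_series_ge0|
                          by move=> _ [U _ <-]; exact: diam_pow_series_ge0|].
move=> _ _ [U [AU Ud] <-] [V [BV Vd] <-].
pose W k := if odd k then V k./2 else U k./2.
apply: (@le_trans _ _ (\sum_(0 <= i <oo) diam_pow r (W i))%E).
  apply: hausdorff_content_ub; last by move=> i; rewrite /W; case: odd.
  move=> x [/AU [k _ Uk]|/BV [k _ Vk]]; [exists k.*2|exists k.*2.+1] => //.
    by rewrite /W odd_double doubleK.
  by rewrite /W /= odd_double /= uphalf_double.
apply: lime_le; first by apply: is_cvg_nneseries => n _ _; exact: diam_pow_ge0.
apply: nearW => n.
apply: (@le_trans _ _ (\sum_(0 <= k < n.*2) diam_pow r (W k))%E).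
  apply: lee_sum_nneg_natr => // [k _ _|]; first exact: diam_pow_ge0.
  by rewrite -addnn leq_addr.
have -> : (\sum_(0 <= k < n.*2) diam_pow r (W k) =
    \sum_(0 <= k < n) diam_pow r (U k) + \sum_(0 <= k < n) diam_pow r (V k))%E.
  rewrite -big_split /=; elim: n => [|n IH]; first by rewrite !big_nil.
  rewrite doubleS !big_nat_recr //= IH -addeA; congr (_ + (_ + _))%E.
    by rewrite /W odd_double doubleK.
  by rewrite /W /= odd_double /= uphalf_double.
by apply: leeD; apply: nneseries_lim_ge => *; exact: diam_pow_ge0.
Qed.

Lemma prehausdorffU r A B :
  (prehausdorff r (A `|` B) <= prehausdorff r A + prehausdorff r B)%E.
Proof.
apply: prehausdorff_le => d d0.
apply: le_trans (leeD (content_le_prehausdorff r A d0) (content_le_prehausdorff r B d0)).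
exact: hausdorff_contentU.
Qed.

(** A set of diameter less than [e] meets at most one of [A] and [B], so a fine cover of the union
    splits into a cover of each. *)
Lemma prehausdorff_separated r e A B : 0 <= r -> 0 < e ->
  (forall x y, A x -> B y -> e <= enorm (x - y)) ->
  (prehausdorff r A + prehausdorff r B <= prehausdorff r (A `|` B))%E.
Proof.
move=> r0 e0 AB.
apply: ereal_sup_add_le; [by exists (hausdorff_content r 1 A), 1 => //=|
  by exists (hausdorff_content r 1 B), 1 => //=|
  by move=> _ [d _ <-]; exact: hausdorff_content_ge0|
  by move=> _ [d _ <-]; exact: hausdorff_content_ge0|].
move=> _ _ [d1 d10 <-] [d2 d20 <-].
pose d := Num.min (e / 2) (Num.min d1 d2).
have d0 : 0 < d by rewrite !lt_min divr_gt0//=; apply/andP.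
have dd1 : d <= d1 by rewrite !ge_min lexx !orbT.
have dd2 : d <= d2 by rewrite !ge_min lexx !orbT.
apply: le_trans (content_le_prehausdorff _ _ d0).
apply: le_trans (leeD (hausdorff_content_anti r A dd1) (hausdorff_content_anti r B dd2)) _.
apply: hausdorff_content_lb => U ABU Ud.
apply: (@le_trans _ _ (\sum_(0 <= i <oo) diam_pow r (U i `&` A) +
                      \sum_(0 <= i <oo) diam_pow r (U i `&` B))%E).
  apply: leeD; apply: hausdorff_content_ub.
  - by move=> x Ax; have [k _ Uk] := ABU x (or_introl Ax); exists k.
  - by move=> i; apply: le_trans (Ud i); apply: diam_sub => x [].
  - by move=> x Bx; have [k _ Uk] := ABU x (or_intror Bx); exists k.
  - by move=> i; apply: le_trans (Ud i); apply: diam_sub => x [].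
rewrite -nneseriesD; [|by move=> *; exact: diam_pow_ge0|by move=> *; exact: diam_pow_ge0].
apply: lee_nneseries => [i _ _|i _]; first by rewrite adde_ge0 ?diam_pow_ge0.
have [A0|/set0P[x [Ux Ax]]] := eqVneq (U i `&` A) set0.
  by rewrite A0 diam_pow0 add0e diam_pow_sub// => x [].
have [B0|/set0P[y [Uy By]]] := eqVneq (U i `&` B) set0.
  by rewrite B0 diam_pow0 adde0 diam_pow_sub// => y [].
have := le_trans (diam_ubound Ux Uy) (Ud i); rewrite lee_fin => xyd.
have : e <= e / 2 by rewrite (le_trans (AB x y Ax By))// (le_trans xyd)// ge_min lexx.
by move=> ?; exfalso; lra.
Qed.

Section FiniteUnion.
Context {I : eqType}.
Implicit Types (s : seq I) (F : I -> set 'rV[R]_p).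

Let union_cons i s F :
  [set x | exists2 j, j \in i :: s & F j x] = F i `|` [set x | exists2 j, j \in s & F j x].
Proof.
apply/seteqP; split => [x [j]|x [Fi|[j js Fj]]].
- by rewrite inE => /orP[/eqP ->|js] Fj; [left|right; exists j].
- by exists i => //; rewrite mem_head.
- by exists j => //; rewrite inE js orbT.
Qed.

(** Stated for an abstract [nu] because it serves both the content at a fixed [delta] and the
    measure itself. *)
Lemma subadditive_bigU (nu : set 'rV[R]_p -> \bar R) s F : nu set0 = 0%E ->
  (forall A B, (nu (A `|` B) <= nu A + nu B)%E) ->
  (nu [set x | exists2 i, i \in s & F i x] <= \sum_(i <- s) nu (F i))%E.
Proof.
move=> nu0 nuU; elim: s => [|i s IH].
  rewrite big_nil (_ : mkset _ = set0) ?nu0//.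
  by apply/seteqP; split => x // [].
by rewrite big_cons union_cons; apply: le_trans (nuU _ _) _; exact: leeD.
Qed.

Lemma prehausdorff_big_separated r e s F : 0 <= r -> 0 < e -> uniq s ->
  (forall i j x y, i \in s -> j \in s -> i != j -> F i x -> F j y -> e <= enorm (x - y)) ->
  (\sum_(i <- s) prehausdorff r (F i) <=
   prehausdorff r [set x | exists2 i, i \in s & F i x])%E.
Proof.
move=> r0 e0; elim: s => [|i s IH]; first by rewrite big_nil prehausdorff_ge0.
move=> /= /andP[si us] sep; rewrite big_cons union_cons.
apply: le_trans (prehausdorff_separated r0 e0 _).
  apply: leeD => //; apply: IH => // j k x y js ks; apply: sep; by rewrite inE ?js ?ks orbT.
move=> x y Fx [j js Fy]; apply: (sep i j) => //; first by rewrite mem_head.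
  by rewrite inE js orbT.
by apply: contraNneq si => ->.
Qed.

End FiniteUnion.

(** A set of diameter [t <= d] satisfies [t^s <= d^(s - r) t^r], so the [s]-content at scale [d] is
    at most [d^(s - r)] times a finite constant and vanishes in the limit. *)
Lemma prehausdorff_dim_lt r s A : 0 <= r -> r < s -> (prehausdorff r A < +oo)%E ->
  prehausdorff s A = 0%E.
Proof.
move=> r0 rs Af; apply/eqP; rewrite eq_le prehausdorff_ge0 andbT.
have s0 : 0 <= s by rewrite ltW// (le_lt_trans r0).
have sr0 : 0 < s - r by rewrite subr_gt0.
have Afin : prehausdorff r A \is a fin_num by rewrite ge0_fin_numE// prehausdorff_ge0.
have bound (d : R) : 0 < d -> (hausdorff_content s d A <= (d `^ (s - r))%:E * prehausdorff r A)%E.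
  move=> d0.
  apply: (@le_trans _ _ ((d `^ (s - r))%:E * hausdorff_content r d A)%E); last first.
    by apply: lee_wpmul2l; rewrite ?lee_fin ?powR_ge0// content_le_prehausdorff.
  rewrite -lee_pdivrMl ?powR_gt0//.
  apply: hausdorff_content_lb => U AU Ud; rewrite lee_pdivrMl ?powR_gt0//.
  apply: le_trans (hausdorff_content_ub _ AU Ud) _.
  rewrite -nneseriesZl; last by move=> *; exact: diam_pow_ge0.
  apply: lee_nneseries => [i _ _|i _]; first exact: diam_pow_ge0.
  have [->|/set0P U0] := eqVneq (U i) set0; first by rewrite !diam_pow0 mule0.
  rewrite !diam_powE//; have := diam_ge0 U0; have := Ud i.
  case: (diam (U i)) => [t| |] //; rewrite !lee_fin => td t0.
  have -> : t `^ s = t `^ (s - r) * t `^ r.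
    rewrite -powRD; first by rewrite subrK.
    by rewrite subrK; apply/implyP => /eqP se; move: (le_lt_trans r0 rs); rewrite se ltxx.
  by rewrite ler_wpM2r ?powR_ge0// ge0_ler_powR ?nnegrE// ltW.
apply: prehausdorff_le => d d0; apply/lee_addgt0Pr => e e0; rewrite add0e.
set M := fine (prehausdorff r A).
have M0 : 0 <= M by rewrite fine_ge0// prehausdorff_ge0.
(* At this scale the factor [t^(s - r)] equals [e / (M + 1)], and its product with [M] is at most
   [e], also when [M] is 0. *)
pose t := (e / (M + 1)) `^ (s - r)^-1.
have t0 : 0 < t by rewrite powR_gt0// divr_gt0// ltr_wpDl.
have dt0 : 0 < Num.min d t by rewrite lt_min d0.
apply: le_trans (hausdorff_content_anti s A (_ : Num.min d t <= d)) _; first by rewrite ge_min lexx.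
apply: le_trans (bound _ dt0) _.
rewrite -(fineK Afin) -/M -EFinM lee_fin.
apply: (@le_trans _ _ (t `^ (s - r) * M)).
  by rewrite ler_wpM2r// ge0_ler_powR ?nnegrE ?ge_min ?lexx ?orbT// ltW.
rewrite /t -powRrM mulVf ?gt_eqF// powRr1 ?divr_ge0 ?addr_ge0 ?(ltW e0)//.
rewrite mulrAC ler_pdivrMr ?ltr_wpDl// ler_wpM2l ?(ltW e0)//.
by rewrite lerDl.
Qed.

End FixedDimension.

Lemma prehausdorff_lipschitz {p q : nat} (r c : R) (A : set 'rV[R]_p)
    (f : 'rV[R]_p -> 'rV[R]_q) : 0 <= r -> 0 < c ->
  (forall x y, A x -> A y -> enorm (f x - f y) <= c * enorm (x - y)) ->
  (prehausdorff r (f @` A) <= (c `^ r)%:E * prehausdorff r A)%E.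
Proof.
move=> r0 c0 fc; apply: prehausdorff_le => d d0.
have dc0 : 0 < d / c by rewrite divr_gt0.
apply: (@le_trans _ _ ((c `^ r)%:E * hausdorff_content r (d / c) A)%E); last first.
  by apply: lee_wpmul2l; rewrite ?lee_fin ?powR_ge0// content_le_prehausdorff.
rewrite -lee_pdivrMl ?powR_gt0//.
apply: hausdorff_content_lb => U AU Ud; rewrite lee_pdivrMl ?powR_gt0//.
have fcU i : forall x y, (U i `&` A) x -> (U i `&` A) y -> enorm (f x - f y) <= c * enorm (x - y).
  by move=> x y [_ Ax] [_ Ay]; exact: fc.
apply: le_trans (hausdorff_content_ub (U := fun i => f @` (U i `&` A)) _ _ _) _.
- by move=> _ [x Ax <-]; have [k _ Uk] := AU x Ax; exists k => //; exists x.
- move=> i; apply: le_trans (diam_image_le (ltW c0) (fcU i)) _.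
  rewrite -lee_pdivlMl//; apply: le_trans (_ : (_ <= diam (U i))%E) _.
    by apply: diam_sub => x [].
  by rewrite (le_trans (Ud i))// muleC.
rewrite -nneseriesZl; last by move=> *; exact: diam_pow_ge0.
apply: lee_nneseries => [i _ _|i _]; first exact: diam_pow_ge0.
apply: le_trans (diam_pow_image_le (ltW c0) r0 (fcU i)) _.
by apply: lee_wpmul2l; rewrite ?lee_fin ?powR_ge0// diam_pow_sub// => x [].
Qed.

End PreHausdorff.

(** * Boxes and grids *)
Lemma exprD_le (R : realType) (n : nat) (a eta : R) : 0 <= a -> 0 < eta ->
  exists2 e, 0 < e & (a + e) ^+ n <= a ^+ n + eta.
Proof.
move=> a0 eta0; set K := n%:R * (a + 1) ^+ n + 1.
have K0 : 0 < K by rewrite ltr_wpDl ?mulr_ge0 ?exprn_ge0 ?addr_ge0.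
exists (Num.min 1 (eta / K)); first by rewrite lt_min ltr01 divr_gt0.
set e := Num.min _ _.
have e0 : 0 < e by rewrite lt_min ltr01 divr_gt0.
have e1 : e <= 1 by rewrite ge_min lexx.
rewrite -lerBlDl subrXX addrAC subrr add0r.
apply: (@le_trans _ _ (e * K)); last first.
  by rewrite -ler_pdivlMr// ge_min lexx orbT.
rewrite ler_wpM2l ?(ltW e0)// /K.
apply: (@le_trans _ _ (\sum_(i < n) (a + 1) ^+ n)); last first.
  by rewrite sumr_const card_ord mulr_natl lerDl.
apply: ler_sum => i _.
have a1 : 1 <= a + 1 by rewrite lerDr.
apply: (@le_trans _ _ ((a + 1) ^+ (n.-1 - i) * (a + 1) ^+ i)).
  apply: ler_pM; rewrite ?exprn_ge0 ?addr_ge0 ?(ltW e0)//.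
    by apply: lerXn2r; rewrite ?nnegrE ?addr_ge0 ?(ltW e0)// lerD2l.
  by apply: lerXn2r; rewrite ?nnegrE ?addr_ge0// lerDl.
by rewrite -exprD ler_weXn2l//; have := ltn_ord i; lia.
Qed.

Lemma onem_expr_ge (R : realType) (n : nat) (t : R) : 0 <= t <= 1 -> 1 - n%:R * t <= (1 - t) ^+ n.
Proof.
move=> /andP[t0 t1]; elim: n => [|n IH]; first by rewrite mul0r subr0 expr0.
have h : 0 <= n%:R * t ^+ 2 by rewrite mulr_ge0 ?sqr_ge0.
rewrite exprS; apply: (@le_trans _ _ ((1 - t) * (1 - n%:R * t))).
  by rewrite -natr1; nra.
by rewrite ler_wpM2l// subr_ge0.
Qed.

(** Letting [t] tend to 0 turns an estimate for sets shrunk by the factor [1 - t] into one without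
    loss. *)
Lemma le_onem_expr_limit (R : realType) (n : nat) (a b : R) : 0 <= a ->
  (forall t, 0 < t < 1 -> (1 - t) ^+ n * a <= b) -> a <= b.
Proof.
move=> a0 h; apply/ler_addgt0Pr => e e0.
set K := n%:R * a + e + 1.
have K0 : 0 < K by rewrite ltr_wpDl// addr_ge0 ?mulr_ge0 ?(ltW e0).
have t01 : 0 < e / K < 1.
  rewrite divr_gt0//= ltr_pdivrMr// mul1r.
  by rewrite /K; have := mulr_ge0 (ler0n R n) a0; lra.
have /andP[t0 t1] := t01.
have := le_trans (ler_wpM2r a0 (onem_expr_ge n (introT andP (conj (ltW t0) (ltW t1))))) (h _ t01).
rewrite mulrBl mul1r lerBlDr => /le_trans; apply; rewrite lerD2l.
rewrite -[n%:R * _ * a]mulrAC mulrA ler_pdivrMr// mulrC ler_wpM2l ?(ltW e0)// /K.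
by rewrite -addrA lerDl addr_ge0 ?(ltW e0).
Qed.

Section Boxes.
Context {R : realType} {p : nat}.
Implicit Types (c o y : 'rV[R]_p) (h l : R) (A : set 'rV[R]_p).

Definition box c l : set 'rV[R]_p := [set y | forall i, c 0 i <= y 0 i <= c 0 i + l].

Definition grid_point o h (x : 'rV[nat]_p) : 'rV[R]_p := \row_i (o 0 i + h * (x 0 i)%:R).

(** The cubes are closed, so neighbours share faces. This is harmless in upper bounds by
    subadditivity, but lower bounds have to shrink the cubes first. *)
Definition cells o h {B : nat} (P : pred 'rV['I_B]_p) : set 'rV[R]_p :=
  [set y | exists2 x, P x & box (grid_point o h (natv x)) h y].

Lemma box_affine c l : 0 < l -> box c l = (fun y => l *: y + c) @` box 0 1.
Proof.
move=> l0; apply/seteqP; split => [y cy|_ [y y01 <-] i].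
  exists (l^-1 *: (y - c)); last by rewrite scalerA mulfV ?gt_eqF// scale1r subrK.
  move=> i; rewrite !mxE add0r; have /andP[y1 y2] := cy i.
  by rewrite mulr_ge0 ?invr_ge0 ?(ltW l0) ?subr_ge0//= ler_pdivrMl// mulr1 lerBlDl.
have := y01 i; rewrite !mxE add0r => /andP[y1 y2].
by rewrite lerDr mulr_ge0 ?(ltW l0)//= addrC lerD2l -[leRHS]mulr1 ler_pM2l.
Qed.

Lemma nat_segment_index (B : nat) (t : R) : (0 < B)%N -> 0 <= t <= B%:R ->
  exists k : 'I_B, k%:R <= t <= k%:R + 1.
Proof.
elim: B => // B IH _ /andP[t0 tB].
have [tlt|tge] := ltP t B%:R.
  have [B0|Bpos] := posnP B; first by move: tlt; rewrite B0 ltNge t0.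
  have [|k hk] := IH Bpos; first by rewrite t0 ltW.
  by exists (widen_ord (leqnSn B) k).
by exists ord_max; rewrite /= tge natr1.
Qed.

Lemma box_sub_cells o h (B : nat) : 0 < h -> (0 < B)%N ->
  box o (h * B%:R) `<=` cells o h (B := B) predT.
Proof.
move=> h0 B0 y yo.
have ex i : exists k : 'I_B, k%:R <= (y 0 i - o 0 i) / h <= k%:R + 1.
  apply: nat_segment_index => //; have /andP[y1 y2] := yo i.
  by rewrite divr_ge0 ?subr_ge0 ?(ltW h0)//= ler_pdivrMr// mulrC lerBlDl.
have [k hk] := fin_all_exists ex.
exists (\row_i k i) => // i; rewrite !mxE.
have := hk i; rewrite ler_pdivlMr// ler_pdivrMr// => /andP[k1 k2]; apply/andP; split; lra.
Qed.

Lemma diam_box c l : 0 <= l -> (diam (box c l) <= (Num.sqrt p%:R * l)%:E)%E.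
Proof.
move=> l0; apply: diam_le => x y xc yc; rewrite lee_fin; apply: enorm_le_coord => // i.
have /andP[? ?] := xc i; have /andP[? ?] := yc i.
by rewrite !mxE ler_norml; apply/andP; split; lra.
Qed.

Lemma box_cell_separated o h e (B : nat) (x x' : 'rV['I_B]_p) y y' :
  0 <= e < h -> x != x' ->
  box (grid_point o h (natv x)) (h - e) y -> box (grid_point o h (natv x')) (h - e) y' ->
  e <= enorm (y - y').
Proof.
move=> /andP[e0 eh] xx' yx yx'.
have [i xi] : exists i, x 0 i != x' 0 i.
  apply/existsP; move: xx'; apply: contraNT; rewrite negb_exists => /forallP h'.
  by apply/eqP/rowP => i; apply/eqP; have := h' i; rewrite negbK.
apply: le_trans (coord_le_enorm _ i).
have := yx i; have := yx' i; rewrite !mxE.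
have [lt|lt|/val_inj/eqP] := ltngtP (x 0 i) (x' 0 i); last by rewrite (negPf xi).
  have hk : h * (x 0 i)%:R + h <= h * (x' 0 i)%:R.
    by rewrite -{2}[h]mulr1 -mulrDr natr1 ler_pM2l ?(le_lt_trans e0)// ler_nat.
  by move=> /andP[? ?] /andP[? ?]; rewrite ler0_norm; lra.
have hk : h * (x' 0 i)%:R + h <= h * (x 0 i)%:R.
  by rewrite -{2}[h]mulr1 -mulrDr natr1 ler_pM2l ?(le_lt_trans e0)// ler_nat.
by move=> /andP[? ?] /andP[? ?]; rewrite ger0_norm; lra.
Qed.

Definition coord_bounded A := exists M, forall x i, A x -> `|x 0 i| <= M.

Lemma coord_bounded_sub_box A : coord_bounded A -> exists2 M, 0 < M &
  A `<=` box (const_mx (- M)) (2 * M).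
Proof.
move=> [M AM]; exists (`|M| + 1); first by rewrite ltr_wpDl.
move=> x Ax i; rewrite !mxE; have := le_trans (AM x i Ax) (ler_norm M).
by rewrite ler_norml => /andP[? ?]; apply/andP; split; lra.
Qed.

Lemma coord_boundedS A A' : A `<=` A' -> coord_bounded A' -> coord_bounded A.
Proof. by move=> AA' [M h]; exists M => x i /AA'; exact: h. Qed.


Lemma coord_boundedU A A' : coord_bounded A -> coord_bounded A' -> coord_bounded (A `|` A').
Proof.
move=> [M AM] [M' AM']; exists (Num.max M M') => x i; rewrite le_max.
by move=> [/AM ->//|/AM' ->]; rewrite orbT.
Qed.

End Boxes.

Lemma card_grid_interval (R : realType) (m : nat) (x rho : R) : (0 < m)%N -> 0 <= rho ->
  exists (L a : nat), L%:R <= 2 * rho * m%:R + 2 /\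
    forall k : nat, `|x - k%:R / m%:R| < rho -> (a <= k < a + L)%N.
Proof.
move=> m0 rho0; have m0' : 0 < m%:R :> R by rewrite ltr0n.
exists (Num.trunc (2 * rho * m%:R + 1)).+1, (Num.trunc (m%:R * (x - rho))).
have h0 : 0 <= 2 * rho * m%:R + 1 by rewrite addr_ge0// mulr_ge0// mulr_ge0.
have /andP[t1 t2] := truncn_itv h0.
split; first by rewrite -natr1; lra.
move=> k; rewrite distrC ltr_distl => /andP[k1 k2].
have {}k1 : m%:R * (x - rho) < k%:R by move: k1; rewrite ltr_pdivlMr// mulrC.
have {}k2 : k%:R < m%:R * (x + rho) by move: k2; rewrite ltr_pdivrMr// mulrC.
have ak : (Num.trunc (m%:R * (x - rho)) <= k)%N.
  by rewrite truncn_le_nat -natr1; lra.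
rewrite ak /=.
rewrite -(ltr_nat R) natrD.
have : m%:R * (x - rho) < (Num.trunc (m%:R * (x - rho)))%:R + 1.
  by rewrite natr1 -truncn_le_nat.
by move: t1 t2; rewrite -natr1; lra.
Qed.

Lemma card_grid_ball (R : realType) (p m : nat) (a : 'rV[R]_p) (rho : R) (P : pred 'rV['I_m]_p) :
  (0 < m)%N -> 0 <= rho ->
  (forall k, P k -> forall i, `|a 0 i - (k 0 i)%:R / m%:R| < rho) ->
  #|P|%:R <= (2 * rho * m%:R + 2) ^+ p.
Proof.
move=> m0 rho0 hP.
have [L hL] := fin_all_exists (fun i => card_grid_interval (a 0 i) m0 rho0).
have [b hb] := fin_all_exists hL.
have P2 : 0 <= 2 * rho * m%:R + 2 by rewrite addr_ge0// mulr_ge0// mulr_ge0.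
pose K := Num.trunc (2 * rho * m%:R + 2).
have LK i : (L i <= K)%N.
  by rewrite /K -(@natrK R (L i)); apply: le_truncn; have [] := hb i.
have K0 : (0 < K)%N.
  rewrite /K ltnNge truncn_le_nat -leNgt; have := mulr_ge0 rho0 (ler0n R m); lra.
pose f (k : 'rV['I_m]_p) : 'rV['I_K.-1.+1]_p := \row_i inord (k 0 i - b i).
have finj : {in P &, injective f}.
  move=> k k' Pk Pk' /rowP ff; apply/rowP => i; apply: val_inj; have := congr1 val (ff i).
  have [_ h] := hb i; have /andP[k1 k2] := h _ (hP _ Pk i); have /andP[k3 k4] := h _ (hP _ Pk' i).
  by have := LK i => LKi; rewrite /f !mxE /= !inordK; lia.
rewrite -(card_in_imset finj).
apply: (@le_trans _ _ (K ^ p)%:R).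
  rewrite ler_nat (leq_trans (max_card _))//.
  by rewrite card_mx card_ord prednK// mul1n.
by rewrite natrX lerXn2r ?nnegrE// truncn_le.
Qed.

(* By compactness only finitely many members of a cover matter; enlarging them
   slightly to open cubes, one counts the points of a fine grid in each. *)
Lemma unit_box_content_gt0 (R : realType) (p : nat) : (0 < p)%N ->
  ((2 ^+ p.+1)^-1%:E <= hausdorff_content p%:R 1 (box 0 1 : set 'rV[R]_p))%E.
Proof.
move=> p0; apply: hausdorff_content_lb => U boxU Ud.
(* For an empty set [fine] sends the diameter [-oo] to 0, and [0 < p] makes the corresponding power
   0, in agreement with [diam_pow]. *)
pose d i := fine (diam (U i)).
have d0 i : 0 <= d i.
  have [U0|/set0P U0] := eqVneq (U i) set0; last by rewrite fine_ge0// diam_ge0.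
  rewrite /d U0 (_ : diam _ = -oo%E)//; apply/eqP.
  by rewrite -leeNy_eq; apply: diam_le.
have dE i : U i !=set0 -> diam (U i) = (d i)%:E.
  move=> U0; rewrite /d fineK// ge0_fin_numE ?diam_ge0//.
  by rewrite (le_lt_trans (Ud i))// ltry.
have dp i : ((d i ^+ p)%:E <= diam_pow p%:R (U i))%E.
  have [U0|/set0P U0] := eqVneq (U i) set0.
    rewrite U0 diam_pow0 lee_fin /d U0 (_ : diam _ = -oo%E) ?expr0n ?gtn_eqF//.
    by apply/eqP; rewrite -leeNy_eq; apply: diam_le.
  by rewrite diam_powE// dE// poweR_EFin powR_mulrn.
have exa i : exists a, forall x, U i x -> enorm (x - a) <= d i.
  have [U0|/set0P [a Ua]] := eqVneq (U i) set0; first by exists 0; rewrite U0.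
  exists a => x Ux; rewrite -lee_fin -dE; last by exists a.
  exact: diam_ubound.
have [a ha] := choice exa.
(* The enlargements cost less than 1/2 in total, because the errors [(2 ^+ i.+2)^-1] sum to less
   than that. The other half is left for [2 ^+ p] times the sum of the [d i ^+ p], whence the
   constant [(2 ^+ p.+1)^-1]. *)
have exe i : exists e, 0 < e /\ (2 * d i + 4 * e) ^+ p <= 2 ^+ p * d i ^+ p + (2 ^+ i.+2)^-1.
  have [||e e0 he] := @exprD_le R p (2 * d i) (2 ^+ i.+2)^-1; first by rewrite mulr_ge0.
    by rewrite invr_gt0 exprn_gt0.
  exists (e / 4); rewrite divr_gt0// -exprMn; split => //.
  by rewrite [4 * _]mulrC divfK.
have [e he] := choice exe.
have cov : box (0 : 'rV[R]_p) 1 `<=` cover setT (fun i => ball (a i) (d i + e i)).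
  move=> x /boxU[i _ Ux]; exists i => //; have [e0 _] := he i.
  have dei : 0 < d i + e i by rewrite ltr_wpDl.
  split=> // j k; rewrite ord1 -ball_normE /=; apply: (@le_lt_trans _ _ (d i)); last by rewrite ltrDl.
  apply: le_trans (ha i x Ux); have := coord_le_enorm (x - a i) k.
  by rewrite !mxE distrC.
have cpt : compact (box (0 : 'rV[R]_p) 1).
  have := @rV_compact R p (fun=> `[0, 1]%classic) (fun=> @segment_compact R 0 1).
  congr compact; apply/seteqP; split => x h i; have := h i; rewrite /= in_itv /= !mxE add0r//.
move: cpt; rewrite compact_cover => /(_ _ _ _ _ cov) [i _|D _ Dcov].
  by have [e0 _] := he i; apply: ball_open; rewrite ltr_wpDl.
pose n := (\max_(i <- finmap.enum_fset D) i).+1.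
have ncov x : box 0 1 x -> exists i : 'I_n, ball (a i) (d i + e i) x.
  move=> /Dcov [i /= iD hi].
  have lt : (i < n)%N by rewrite ltnS (leq_bigmax_seq (F := id)).
  by exists (Ordinal lt).
(* With [1 / m] below each of the finitely many [e i], the boundary term 2 in the count of grid
   points is absorbed: [2 (d i + e i) m + 2 <= (2 d i + 4 e i) m]. *)
have [m m0 hm] : exists2 m, (0 < m)%N & forall i, (i < n)%N -> 1 <= e i * m%:R.
  exists (\sum_(i < n) (Num.trunc (e i)^-1).+1)%N.
    by rewrite big_ord_recl addSn.
  move=> i lt; have [e0 _] := he i; rewrite mulrC -ler_pdivrMr// mul1r.
  have /andP[_ /ltW t2] : (Num.trunc (e i)^-1)%:R <= (e i)^-1 < (Num.trunc (e i)^-1).+1%:R.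
    by apply: truncn_itv; rewrite invr_ge0 ltW.
  apply: le_trans t2 _; rewrite ler_nat.
  by rewrite (bigD1 (Ordinal lt))//= leq_addr.
have m0' : 0 < m%:R :> R by rewrite ltr0n.
pose g (k : 'rV['I_m]_p) : 'rV[R]_p := \row_j ((k 0 j)%:R / m%:R).
have gbox k : box 0 1 (g k).
  move=> j; rewrite !mxE add0r divr_ge0//= ler_pdivrMr// mul1r ler_nat.
  exact: ltnW.
pose P (i : 'I_n) : pred 'rV['I_m]_p :=
  [pred k : 'rV['I_m]_p | [forall j, `|a i 0 j - (k 0 j)%:R / m%:R| < d i + e i]].
have cnt : (m ^ p <= \sum_(i < n) #|P i|)%N.
  have -> : (m ^ p = \sum_(k : 'rV['I_m]_p) 1)%N by rewrite sum1_card card_mx card_ord mul1n.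
  under [leqRHS]eq_bigr do rewrite -sum1_card big_mkcond.
  rewrite exchange_big; apply: leq_sum => k _ /=.
  have [i hi] := ncov _ (gbox k).
  rewrite (bigD1 i)//= (_ : k \in P i) ?leq_addr//.
  rewrite inE; apply/forallP => j; have := hi.2 0 j.
  by rewrite -ball_normE /= mxE.
have bnd : 1 <= \sum_(i < n) (2 ^+ p * d i ^+ p + (2 ^+ i.+2)^-1).
  rewrite -(@ler_pM2l _ (m%:R ^+ p)) ?exprn_gt0// mulr1 mulr_sumr.
  apply: (@le_trans _ _ (\sum_(i < n) #|P i|%:R)); first by rewrite -natr_sum -natrX ler_nat.
  apply: ler_sum => i _; have [e0 hi] := he i.
  apply: le_trans (ler_wpM2l (exprn_ge0 _ (ltW m0')) hi).
  rewrite -exprMn.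
  apply: (@le_trans _ _ ((2 * (d i + e i) * m%:R + 2) ^+ p)).
    apply: card_grid_ball => //; first by rewrite addr_ge0// ltW.
    by move=> k /forallP.
  have := hm i (ltn_ord i) => hmi.
  apply: lerXn2r; rewrite ?nnegrE.
  - by rewrite addr_ge0// mulr_ge0// mulr_ge0// addr_ge0// ltW.
  - by rewrite mulr_ge0 ?addr_ge0 ?mulr_ge0// ltW.
  - by rewrite mulrC; lra.
have half k : \sum_(i < k) (2 ^+ i.+2)^-1 = 1 / 2 - (2 ^+ k.+1)^-1 :> R.
  elim: k => [|k IH]; first by rewrite big_ord0 expr1; lra.
  by rewrite big_ord_recr /= IH !exprS !invfM; lra.
move: bnd; rewrite big_split /= half -mulr_sumr => bnd.
have {}bnd : (2 ^+ p.+1)^-1 <= \sum_(i < n) d i ^+ p.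
  rewrite exprS invfM -ler_pdivlMr ?invr_gt0 ?exprn_gt0// invrK mulrC.
  by have : 0 < (2 ^+ n.+1)^-1 :> R by [rewrite invr_gt0 exprn_gt0|]; lra.
apply: le_trans (_ : (_ <= (\sum_(i < n) d i ^+ p)%:E)%E) _; first by rewrite lee_fin.
apply: (@le_trans _ _ (\sum_(0 <= i < n) diam_pow p%:R (U i))%E); last first.
  by apply: nneseries_lim_ge => *; exact: diam_pow_ge0.
by rewrite -sumEFin big_mkord; apply: lee_sum => i _; exact: dp.
Qed.

(** * Volume *)
Section Volume.
Context {R : realType} {p : nat}.
Implicit Types (c o y : 'rV[R]_p) (h l r : R) (A : set 'rV[R]_p).

Lemma prehausdorff_affine r c A : 0 < r ->
  prehausdorff p%:R [set r *: y + c | y in A] = ((r ^+ p)%:E * prehausdorff p%:R A)%E.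
Proof.
move=> r0; apply/eqP; rewrite eq_le; apply/andP; split.
  rewrite -powR_mulrn ?(ltW r0)//; apply: prehausdorff_lipschitz => // x y _ _.
  by rewrite opprD addrACA subrr addr0 -scalerBr enormZ ger0_norm// ltW.
have {1}-> : A = [set r^-1 *: (z - c) | z in [set r *: y + c | y in A]].
  rewrite image_comp; apply/seteqP; split => [x Ax|_ [x Ax <-]] /=.
    by exists x => //=; rewrite addrK scalerA mulVf ?gt_eqF// scale1r.
  by rewrite addrK scalerA mulVf ?gt_eqF// scale1r.
rewrite -lee_pdivlMl ?exprn_gt0// -exprVn -powR_mulrn ?invr_ge0 ?(ltW r0)//.
apply: prehausdorff_lipschitz; rewrite ?invr_gt0// => x y _ _.
by rewrite -scalerBr opprB addrA subrK enormZ ger0_norm// invr_ge0 ltW.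
Qed.

(** Left unevaluated: to normalize by it, it suffices that it is finite and, for [0 < p],
    positive. *)
Definition unit_mass : \bar R := prehausdorff p%:R (box (0 : 'rV[R]_p) 1).

(** The [m ^ p] cubes of side [1 / m] have diameter at most [sqrt p / m], so their contributions add
    up to at most [(sqrt p)^p], whatever [m] is. *)
Lemma unit_mass_lty : (unit_mass < +oo)%E.
Proof.
suff : (unit_mass <= ((Num.sqrt p%:R) ^+ p)%:E)%E by move/le_lt_trans; apply; rewrite ltry.
apply: prehausdorff_le => d d0.
pose m := (Num.trunc (Num.sqrt p%:R / d)).+1.
have m0 : 0 < m%:R :> R by rewrite ltr0n.
have md : Num.sqrt p%:R * m%:R^-1 <= d.
  rewrite ler_pdivrMr// -ler_pdivrMl// mulrC ltW//.
  have /andP[_] : (Num.trunc (Num.sqrt p%:R / d))%:R <= Num.sqrt p%:R / d < m%:R.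
    by apply: truncn_itv; rewrite divr_ge0 ?sqrtr_ge0 ?(ltW d0).
  by [].
have sub : box (0 : 'rV[R]_p) 1 `<=` [set x | exists2 i, i \in index_enum 'rV['I_m]_p &
    box (grid_point 0 m%:R^-1 (natv i)) m%:R^-1 x].
  move=> x x01; have [|//||i _ hi] := @box_sub_cells R p 0 m%:R^-1 m _ _ x.
  - by rewrite invr_gt0.
  - by rewrite mulVf ?gt_eqF.
  - by exists i => //; rewrite mem_index_enum.
apply: le_trans (hausdorff_content_sub _ _ sub) _.
apply: le_trans (subadditive_bigU _ _ (hausdorff_content0 _ _) (hausdorff_contentU _ _)) _.
apply: (@le_trans _ _ (\sum_(i : 'rV['I_m]_p) ((Num.sqrt p%:R * m%:R^-1) ^+ p)%:E)%E).
  apply: lee_sum => i _; set b := box _ _.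
  have bd : (diam b <= (Num.sqrt p%:R * m%:R^-1)%:E)%E by apply: diam_box; rewrite invr_ge0 ltW.
  apply: le_trans (hausdorff_content_diam _ _) _; first by apply: le_trans bd _; rewrite lee_fin.
  have [->|/set0P b0] := eqVneq b set0.
    by rewrite diam_pow0 lee_fin exprn_ge0// mulr_ge0 ?sqrtr_ge0 ?invr_ge0 ?(ltW m0).
  rewrite diam_powE//; move: bd (diam_ge0 b0); case: (diam b) => [t| |]//.
  rewrite !lee_fin => tb t0; rewrite powR_mulrn//.
  by rewrite lerXn2r ?nnegrE// (le_trans t0 tb).
rewrite sumEFin lee_fin sumr_const card_mx card_ord mul1n exprMn exprVn.
by rewrite -[leLHS]mulr_natr natrX divfK// expf_neq0// gt_eqF.
Qed.

Lemma prehausdorff_box c l : 0 < l ->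
  prehausdorff p%:R (box c l) = ((l ^+ p)%:E * unit_mass)%E.
Proof. by move=> l0; rewrite box_affine// prehausdorff_affine. Qed.

Lemma prehausdorff_boxE c l : 0 < l ->
  prehausdorff p%:R (box c l) = (l ^+ p * fine unit_mass)%:E.
Proof.
move=> l0; rewrite prehausdorff_box// EFinM fineK//.
by rewrite ge0_fin_numE ?unit_mass_lty// prehausdorff_ge0.
Qed.

(** An outer volume, defined for every set. On a set of infinite measure [fine] returns 0, which is
    why the comparisons below ask for [coord_bounded]. *)
Definition vol A : R := fine (prehausdorff p%:R A) / fine unit_mass.

Lemma prehausdorff_fin_num A : coord_bounded A -> prehausdorff p%:R A \is a fin_num.
Proof.
move=> /coord_bounded_sub_box[M M0 AM]; rewrite ge0_fin_numE ?prehausdorff_ge0//.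
apply: le_lt_trans (prehausdorff_sub _ AM) _.
rewrite prehausdorff_box ?mulr_gt0//.
by rewrite lte_mul_pinfty// ?lee_fin ?exprn_ge0 ?mulr_ge0 ?(ltW M0)// unit_mass_lty.
Qed.

Lemma vol_ge0 A : 0 <= vol A.
Proof. by rewrite divr_ge0// fine_ge0// prehausdorff_ge0. Qed.

Lemma vol_sub A A' : coord_bounded A' -> A `<=` A' -> vol A <= vol A'.
Proof.
move=> bA' AA'; rewrite ler_wpM2r ?invr_ge0 ?fine_ge0 ?prehausdorff_ge0//.
rewrite fine_le ?prehausdorff_fin_num ?prehausdorff_sub//.
exact: coord_boundedS bA'.
Qed.

Lemma vol_affine r c A : 0 < r -> vol [set r *: y + c | y in A] = r ^+ p * vol A.
Proof.
move=> r0; rewrite /vol prehausdorff_affine// mulrA; congr (_ / _).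
have := prehausdorff_ge0 p%:R A; case: (prehausdorff _ A) => [t| |]//= _.
by rewrite gt0_muley ?lte_fin ?exprn_gt0//= mulr0.
Qed.

Lemma volU_le A A' : coord_bounded A -> coord_bounded A' -> vol (A `|` A') <= vol A + vol A'.
Proof.
move=> bA bA'; rewrite /vol -mulrDl ler_wpM2r ?invr_ge0 ?fine_ge0 ?prehausdorff_ge0//.
rewrite -fineD ?prehausdorff_fin_num// fine_le ?prehausdorffU//.
  by rewrite prehausdorff_fin_num//; exact: coord_boundedU.
by rewrite fin_numD !prehausdorff_fin_num.
Qed.

Lemma vol_separated (e : R) A A' : coord_bounded A -> coord_bounded A' -> 0 < e ->
  (forall x y, A x -> A' y -> e <= enorm (x - y)) -> vol A + vol A' <= vol (A `|` A').
Proof.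
move=> bA bA' e0 sep; rewrite /vol -mulrDl ler_wpM2r ?invr_ge0 ?fine_ge0 ?prehausdorff_ge0//.
rewrite -fineD ?prehausdorff_fin_num// fine_le ?(prehausdorff_separated _ e0)//.
  by rewrite fin_numD !prehausdorff_fin_num.
by rewrite prehausdorff_fin_num//; exact: coord_boundedU.
Qed.

Hypothesis p0 : (0 < p)%N.

Lemma unit_mass_gt0 : (0 < unit_mass)%E.
Proof.
apply: lt_le_trans (le_trans (unit_box_content_gt0 _ p0) (content_le_prehausdorff _ _ ltr01)).
by rewrite lte_fin invr_gt0 exprn_gt0.
Qed.

Lemma fine_unit_mass_gt0 : 0 < fine unit_mass.
Proof. by rewrite fine_gt0// unit_mass_gt0 unit_mass_lty. Qed.

Lemma prehausdorffE A : coord_bounded A ->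
  prehausdorff p%:R A = (fine unit_mass * vol A)%:E.
Proof.
move=> bA; rewrite /vol mulrC divfK ?gt_eqF ?fine_unit_mass_gt0//.
by rewrite fineK// prehausdorff_fin_num.
Qed.

Lemma vol_box c l : 0 < l -> vol (box c l) = l ^+ p.
Proof.
move=> l0; rewrite box_affine// vol_affine//.
by rewrite /vol divff ?mulr1// gt_eqF// fine_unit_mass_gt0.
Qed.

Lemma vol_le_cells o h (B : nat) (P : pred 'rV['I_B]_p) A : 0 < h ->
  A `<=` cells o h P -> vol A <= h ^+ p * #|P|%:R.
Proof.
move=> h0 AP; have K0 := fine_unit_mass_gt0.
have le1 : (prehausdorff p%:R A <= (h ^+ p * #|P|%:R * fine unit_mass)%:E)%E.
  apply: (@le_trans _ _ (prehausdorff p%:R [set y | exists2 x, x \in enum P &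
      box (grid_point o h (natv x)) h y])).
    apply: prehausdorff_sub => y /AP[x Px yx]; exists x => //.
    by rewrite mem_enum.
  apply: le_trans (subadditive_bigU _ _ (prehausdorff0 _) (prehausdorffU _)) _.
  under eq_bigr do rewrite prehausdorff_boxE//.
  rewrite sumEFin lee_fin big_const_seq count_predT iter_addr_0 -cardE.
  by rewrite mulrAC mulr_natr.
rewrite /vol ler_pdivrMr// -(@lee_fin R) fineK// ge0_fin_numE ?prehausdorff_ge0//.
by rewrite (le_lt_trans le1) ?ltry.
Qed.

(** Shrinking each closed cube to side [(1 - t) * h] at its lower corner leaves gaps [t * h], so the
    measures add up; then [t] tends to 0. *)
Lemma vol_ge_cells o h (B : nat) (P : pred 'rV['I_B]_p) A : 0 < h -> coord_bounded A ->
  cells o h P `<=` A -> h ^+ p * #|P|%:R <= vol A.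
Proof.
move=> h0 bA PA; have K0 := fine_unit_mass_gt0.
apply: (@le_onem_expr_limit _ p); first by rewrite mulr_ge0// exprn_ge0// ltW.
move=> t /andP[t0 t1].
rewrite mulrA -exprMn -(@ler_pM2r _ (fine unit_mass))// [leRHS]mulrC.
rewrite -(@lee_fin R) -prehausdorffE//.
have hE : (1 - t) * h = h - t * h by rewrite mulrBl mul1r.
apply: (@le_trans _ _ (prehausdorff p%:R [set y | exists2 x, x \in enum P &
      box (grid_point o h (natv x)) ((1 - t) * h) y])); last first.
  apply: prehausdorff_sub => y [x xP yx]; apply: PA; exists x.
    by move: xP; rewrite mem_enum.
  move=> i; have := yx i => /andP[-> y2] /=; apply: le_trans y2 _.
  by rewrite lerD2l hE gerBl mulr_ge0 ?ltW.
apply: le_trans (prehausdorff_big_separated _ (_ : 0 < t * h) _ _).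
- under eq_bigr do rewrite prehausdorff_boxE ?mulr_gt0 ?subr_gt0//.
  rewrite sumEFin lee_fin big_const_seq count_predT iter_addr_0 -cardE.
  by rewrite mulrAC mulr_natr.
- by [].
- by rewrite mulr_gt0.
- exact: enum_uniq.
- move=> x x' y y' _ _ xx'; rewrite hE; apply: box_cell_separated => //.
  by rewrite mulr_ge0 ?ltW//= gtr_pMl.
Qed.

End Volume.

(** * Log-concave sequences *)
(* Grünbaum's argument for a log-concave sequence: [f] lies below the geometric
   sequence through [f J.-1] and [f J], so the lower bound on its sum, which
   says that [J] is essentially the barycenter, forces [f J] to be about 1/e. *)
Lemma log_concave_grunbaum (R : realType) (f : nat -> R) (J : nat) (beta : R) :
  (forall i, 0 <= f i <= 1) -> (forall i, f i.+1 <= f i) ->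
  (forall i, f i * f i.+2 <= f i.+1 ^+ 2) ->
  (forall i, f i - f i.+1 <= beta) -> f 0%N = 1 -> (0 < J)%N ->
  20 * beta < 1 -> J%:R - 2 <= \sum_(i < J + J) f i ->
  (expR 1)^-1 - 8 * expR 5 * beta <= f J.
Proof.
move=> f01 fdec flog fslab f0 J0 bsmall fsum.
have [a1|a1] := leP (expR 1)^-1 (f J).
  apply: le_trans a1; rewrite gerBl mulr_ge0 ?mulr_ge0 ?expR_ge0//.
  by apply: le_trans (fslab 0%N); rewrite subr_ge0.
case: J J0 fsum a1 => // K _ fsum a1.
set b := f K; set a := f K.+1.
have ba : b - a <= beta := fslab K.
have b0 : 0 <= b by have /andP[] := f01 K.
have a0 : 0 <= a by have /andP[] := f01 K.+1.
have beta0 : 0 <= beta by apply: le_trans (fslab 0%N); rewrite subr_ge0.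
have fmon i j : (i <= j)%N -> f j <= f i.
  by move=> /subnK <-; elim: (j - i)%N => [|k IH]; rewrite ?addSn ?add0n//; exact: le_trans (fdec _) IH.
have ratio (r : R) i k : 0 <= r -> f i.+1 <= r * f i -> f (i + k).+1 <= r * f (i + k)%N.
  move=> r0 h; elim: k => [|k IH]; first by rewrite addn0.
  rewrite addnS; have := flog (i + k)%N; have /andP[fk0 _] := f01 (i + k)%N.
  have /andP[fk1 _] := f01 (i + k).+1; have /andP[fk2 _] := f01 (i + k).+2.
  move: fk0; rewrite le_eqVlt => /orP[/eqP fk0 _|fk0 h2].
    have -> : f (i + k).+2 = 0.
      by apply/eqP; rewrite eq_le fk2 fk0 fmon// -addn2 leq_addr.
    by rewrite mulr_ge0.
  rewrite -(ler_pM2l fk0); apply: le_trans h2 _; rewrite expr2 mulrCA mulrA.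
  by rewrite ler_wpM2r.
have split_sum : \sum_(i < K.+1 + K.+1) f i =
    \sum_(j < K.+1) f (K - j)%N + \sum_(j < K.+1) f (K.+1 + j)%N.
  rewrite big_split_ord /=; congr (_ + _).
  rewrite (reindex_inj rev_ord_inj) /=; apply: eq_bigr => i _.
  by rewrite subSS.
rewrite split_sum in fsum.
have geom_tail (r : R) : 0 <= r < 1 -> f K.+1 <= r * f K ->
    (1 - r) * \sum_(j < K.+1) f (K.+1 + j)%N <= a.
  move=> /andP[r0 r1] h.
  have hj j : f (K.+1 + j)%N <= a * r ^+ j.
    elim: j => [|j IH]; first by rewrite addn0 expr0 mulr1.
    rewrite addnS; apply: le_trans (_ : r * f (K.+1 + j)%N <= _).
      by rewrite !addSn -addnS; exact: ratio.
    by rewrite exprS mulrCA ler_wpM2l.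
  apply: (@le_trans _ _ ((1 - r) * \sum_(j < K.+1) a * r ^+ j)).
    by apply: ler_wpM2l; rewrite ?subr_ge0 ?(ltW r1)//; apply: ler_sum => j _.
  rewrite -mulr_sumr mulrCA -[1 - r]opprB mulNr -subrX1 opprB.
  by rewrite -[leRHS]mulr1 ler_wpM2l// gerBl exprn_ge0.
(* If [f] at least halves at [K.+1], then [b <= 2 * beta]. The last four terms of the head then sum
   to at most [14 * beta < 1] and the tail to at most [2 * a <= 2 * beta], so the whole sum falls
   short of the assumed lower bound. *)
have [ab|ba2] := leP (2 * a) b.
  have b2 : b <= 2 * beta by lra.
  have tail : \sum_(j < K.+1) f (K.+1 + j)%N <= 2 * a.
    have := @geom_tail (1 / 2); rewrite (_ : 1 - 1 / 2 = 1 / 2); last by lra.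
    by move=> h; have {h} : 1 / 2 * \sum_(j < K.+1) f (K.+1 + j)%N <= a;
      [apply: h; [apply/andP; split; lra|rewrite -/a -/b; lra]|lra].
  have up j : (j <= K)%N -> f (K - j)%N <= b + j%:R * beta.
    elim: j => [|j IH] jK; first by rewrite subn0 mul0r addr0.
    have := fslab (K - j.+1)%N; rewrite -subSn// subSS => h; have := IH (ltnW jK).
    by rewrite -natr1; lra.
  have K3 : (3 <= K)%N.
    rewrite leqNgt; apply/negP => K2; have := up K (leqnn K); rewrite subnn f0.
    have : K%:R * beta <= 2 * beta by rewrite ler_wpM2r// ler_nat.
    by lra.
  have : \sum_(j < K.+1) f (K - j)%N <= 1 + (K.+1 - 4)%:R.
    rewrite -(big_mkord xpredT (fun j => f (K - j)%N)) (@big_cat_nat _ _ _ 4)//=.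
    apply: lerD; last first.
      rewrite -[leRHS]mulr1 mulrC mulr_natr -sumr_const_nat; apply: ler_sum => j _.
      by have /andP[] := f01 (K - j)%N.
    rewrite !big_nat_recl// big_geq// addr0.
    have := up 0%N isT; have := up 1%N (leq_trans _ K3); have := up 2%N (leq_trans _ K3).
    have := up 3%N K3 => u3 /(_ isT) u2 /(_ isT) u1 u0.
    by move: u0 u1 u2 u3; rewrite /=; lra.
  by rewrite natrB//; move: fsum; lra.
have ap : 0 < a by lra.
have aleb : a <= b := fdec K.
have bp : 0 < b by lra.
set r := a / b; have rp : 0 < r by rewrite divr_gt0.
have rb : r * b = a by rewrite divfK// gt_eqF.
have r1 : r <= 1 by rewrite ler_pdivrMr// mul1r.
have back k : (k <= K)%N -> r * f k <= f k.+1.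
  move=> kK; rewrite leNgt; apply/negP => lt.
  have /andP[fk1 _] := f01 k.+1.
  have fk : 0 < f k.
    by have /andP[] := f01 k; rewrite le_eqVlt => /orP[/eqP fk0|//]; move: lt; rewrite -fk0 mulr0 ltNge fk1.
  have := @ratio (f k.+1 / f k) k (K - k)%N; rewrite subnKC// divfK ?gt_eqF//.
  move=> /(_ (divr_ge0 fk1 (ltW fk)) (lexx _)); rewrite -/a -/b; apply/negP; rewrite -ltNge.
  by rewrite -rb ltr_pM2r// ltr_pdivrMr.
have head j : (j <= K)%N -> f (K - j)%N * r ^+ j.+1 <= a.
  elim: j => [|j IH] jK; first by rewrite subn0 expr1 mulrC rb.
  apply: le_trans (IH (ltnW jK)); rewrite [in leLHS]exprS mulrA ler_wpM2r ?exprn_ge0 ?(ltW rp)//.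
  by rewrite mulrC; have := back (K - j.+1)%N (leq_subr _ _); rewrite -subSn// subSS.
move: r1; rewrite le_eqVlt => /orP[/eqP r1|r1].
  have := head K (leqnn K); rewrite subnn f0 r1 expr1n mulr1 => a1'.
  by move: a1; rewrite ltNge (le_trans _ a1')// invf_le1 ?expR_gt0// -expR0 ler_expR.
set q := 1 - r; have q0 : 0 < q by rewrite subr_gt0.
have qb : q * b = b - a by rewrite mulrBl mul1r rb.
have q12 : q < 1 / 2 by rewrite -(ltr_pM2r bp) qb; lra.
(* The geometric majorant [a * r^-(j + 1)] of [f (K - j)] reaches 1 at the least exponent with
   [r ^+ m <= a]; before that point the majorant is used, after it the trivial bound 1. *)
have exm : exists m, r ^+ m <= a.
  by exists K.+1; have := head K (leqnn K); rewrite subnn f0 mul1r.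
case: (ex_minnP exm) => -[|m] rma minm.
  by move: a1; rewrite ltNge (le_trans _ rma)// expr0 invf_le1 ?expR_gt0// -expR0 ler_expR.
have mK : (m <= K)%N.
  by rewrite -ltnS; apply: minm; have := head K (leqnn K); rewrite subnn f0 mul1r.
have arm : a < r ^+ m by rewrite ltNge; apply/negP => /minm; rewrite ltnn.
have tail : q * \sum_(j < K.+1) f (K.+1 + j)%N <= a.
  by apply: geom_tail; rewrite ?(ltW rp) ?r1// -/a -/b rb.
have first : q * \sum_(j < m) f (K - j)%N <= 1 - a.
  apply: (@le_trans _ _ (\sum_(0 <= j < m) (a * r^-1 ^+ j.+1 - a * r^-1 ^+ j))).
    rewrite mulr_sumr big_mkord; apply: ler_sum => j _.
    have rj : 0 < r ^+ j.+1 by rewrite exprn_gt0.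
    have fj : f (K - j)%N <= a * r^-1 ^+ j.+1.
      by rewrite exprVn ler_pdivlMr// head// (leq_trans (ltnW (ltn_ord j)) mK).
    apply: (@le_trans _ _ (q * (a * r^-1 ^+ j.+1))); first by rewrite ler_wpM2l// ltW.
    rewrite /q mulrBl mul1r lerD2l lerN2 exprS mulrCA [r * _]mulrA mulfV ?gt_eqF//.
    by rewrite mul1r.
  rewrite (telescope_sumr (fun j => a * r^-1 ^+ j))// expr0 mulr1 lerB//.
  by rewrite exprVn ler_pdivrMr ?exprn_gt0// mul1r ltW.
have second : \sum_(m <= j < K.+1) f (K - j)%N <= (K.+1 - m)%:R.
  rewrite -[leRHS]mulr1 mulrC mulr_natr -sumr_const_nat; apply: ler_sum => j _.
  by have /andP[] := f01 (K - j)%N.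
(* After multiplication by [q], the head contributes [1 - a] and the tail [a]. These add up to 1,
   and what remains of the lower bound on the sum is [q (m - 2) <= 1]. *)
have qm : q * m.+1%:R <= 1 + 3 * q.
  move: fsum; rewrite -(ler_pM2l q0) mulrDr.
  rewrite -(big_mkord xpredT (fun j => f (K - j)%N)) (@big_cat_nat _ _ _ m)//=; last exact: leqW.
  rewrite big_mkord mulrDr => fsum.
  have := ler_wpM2l (ltW q0) second; rewrite natrB; last exact: leqW.
  move: fsum first tail; rewrite -!natr1; set S1 := \sum_(_ < m) _.
  by set S2 := \sum_(_ < K.+1) _; set S3 := \sum_(_ <= _ < _) _; lra.
have rexp : expR (- (q * (1 + 2 * q))) <= r.
  rewrite expRN -[leRHS]invrK lef_pV2 ?posrE ?expR_gt0 ?invr_gt0//.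
  apply: le_trans (expR_ge1Dx _); rewrite -div1r ler_pdivrMr//.
  have -> : r = 1 - q by rewrite /q; lra.
  have : 0 <= q * (1 - 2 * q) by rewrite mulr_ge0 ?(ltW q0)//; lra.
  have : 0 <= q ^+ 2 by rewrite sqr_ge0.
  by rewrite expr2; nra.
have aexp : expR (- 1 - 8 * q) <= a.
  apply: le_trans rma; apply: (@le_trans _ _ (expR (- (q * (1 + 2 * q))) ^+ m.+1)); last first.
    by rewrite lerXn2r// nnegrE ?expR_ge0 ?(ltW rp).
  rewrite -expRM_natl ler_expR; nra.
(* Since [q < 1/2], the exponent [-1 - 8 q] is above -5. This crude bound on [a], hence on [b],
   converts [q * b = b - a <= beta] into [q <= expR 5 * beta]. *)
have a5 : expR (- 5) <= a by apply: le_trans aexp; rewrite ler_expR; lra.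
have qbeta : q <= expR 5 * beta.
  have : q * expR (- 5) <= beta.
    apply: le_trans ba; rewrite -qb ler_wpM2l ?(ltW q0)//; exact: le_trans aleb.
  by rewrite expRN ler_pdivrMr ?expR_gt0// mulrC.
have : expR (- 1) * (1 - 8 * q) <= a.
  by apply: le_trans aexp; rewrite expRD ler_wpM2l ?expR_ge0// expR_ge1Dx.
rewrite expRN mulrBr mulr1; apply: le_trans.
rewrite lerB// -mulrA.
apply: (@le_trans _ _ (8 * q)); last by rewrite ler_wpM2l.
by rewrite ler_piMl ?mulr_ge0 ?(ltW q0)// invf_le1 ?expR_gt0// -expR0 ler_expR.
Qed.

(** * The Brunn-Minkowski inequality *)
Section DotProduct.
Context {R : realType} {p : nat}.
Implicit Types (u x y : 'rV[R]_p) (a : R).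

Lemma dotvDr u x y : dotv u (x + y) = dotv u x + dotv u y.
Proof. by rewrite /dotv -big_split; apply: eq_bigr => i _; rewrite mxE mulrDr. Qed.

Lemma dotvZr u a x : dotv u (a *: x) = a * dotv u x.
Proof. by rewrite /dotv mulr_sumr; apply: eq_bigr => i _; rewrite mxE mulrCA. Qed.

Lemma dotvNr u x : dotv u (- x) = - dotv u x.
Proof. by rewrite -scaleN1r dotvZr mulN1r. Qed.

Lemma dotvBr u x y : dotv u (x - y) = dotv u x - dotv u y.
Proof. by rewrite dotvDr dotvNr. Qed.

Lemma dotvNl u x : dotv (- u) x = - dotv u x.
Proof. by rewrite /dotv -sumrN; apply: eq_bigr => i _; rewrite mxE mulNr. Qed.

Lemma dotv0r u : dotv u 0 = 0.
Proof. by rewrite -(scale0r 0) dotvZr mul0r. Qed.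

Lemma dotv_sumr (I : Type) (s : seq I) (P : pred I) (F : I -> 'rV[R]_p) u :
  dotv u (\sum_(i <- s | P i) F i) = \sum_(i <- s | P i) dotv u (F i).
Proof. by apply: (big_morph (dotv u)) => [x y|]; [exact: dotvDr|exact: dotv0r]. Qed.

Lemma dotv_le_enorm u x : dotv u x <= (\sum_i `|u 0 i|) * enorm x.
Proof.
rewrite /dotv mulr_suml; apply: ler_sum => i _; apply: le_trans (ler_norm _) _.
by rewrite normrM ler_wpM2l// coord_le_enorm.
Qed.

Lemma dotv_continuous u : continuous (dotv u : 'rV[R]_p -> R).
Proof.
rewrite /dotv; elim: (index_enum _) => [|i s IH].
  by under eq_fun do rewrite big_nil; exact: cst_continuous.
under eq_fun do rewrite big_cons.
move=> x; apply: (@continuousD _ _ _ (fun y : 'rV[R]_p => u 0 i * y 0 i)); last exact: IH.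
by apply: continuousM; [exact: cst_continuous|exact: coord_continuous].
Qed.

Lemma dotv_max (C : set 'rV[R]_p) u : compact C -> C !=set0 ->
  exists2 a, C a & forall y, C y -> dotv u y <= dotv u a.
Proof.
move=> cC C0; have [|a aC amax] := @EVT_max_rV R p (dotv u) C C0 cC.
  by apply: continuous_subspaceT => x; exact: dotv_continuous.
exists a; first by rewrite inE in aC.
by move=> y Cy; apply: amax; rewrite inE.
Qed.

End DotProduct.

Section ConvexSets.
Context {R : realType} {p : nat}.
Implicit Types (u x y c : 'rV[R]_p) (K C A : set 'rV[R]_p) (r t : R).

Definition segment_closed K := forall x y t, K x -> K y -> 0 <= t <= 1 ->
  K ((1 - t) *: x + t *: y).

Lemma convex_set_segment K : convex_set (R := R) (M := 'rV[R]_p) K -> segment_closed K.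
Proof.
move=> cK x y t Kx Ky t01.
have /andP[t0 t1] := t01.
have h0 : 0 <= t by []. have h1 : t <= 1 by [].
have := cK y x (Itv01 h0 h1); rewrite !inE => /(_ Ky Kx).
by rewrite addrC.
Qed.

Lemma segment_closed_mean (I : finType) (P : pred I) (F : I -> 'rV[R]_p) K :
  segment_closed K -> (forall i, P i -> K (F i)) -> (0 < #|P|)%N ->
  K (#|P|%:R^-1 *: \sum_(i | P i) F i).
Proof.
move=> cK; have -> : \sum_(i | P i) F i = \sum_(i <- enum P) F i by rewrite big_enum.
rewrite cardE => KF; have {KF} : forall i, i \in enum P -> K (F i).
  by move=> i; rewrite mem_enum; exact: KF.
elim: (enum P) => [//|i s IH] hs _.
have Ki : K (F i) by apply: hs; rewrite mem_head.
have [s0|s0] := posnP (size s); first by rewrite /= s0 invr1 scale1r big_cons (size0nil s0) big_nil addr0.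
have := cK _ _ ((size s).+1%:R^-1) (IH (fun j js => hs j (mem_behead (s := i :: s) js)) s0) Ki.
have n0 : (size s).+1%:R != 0 :> R by rewrite pnatr_eq0.
have s0' : (size s)%:R != 0 :> R by rewrite pnatr_eq0 -lt0n.
rewrite big_cons scalerDr addrC scalerA.
rewrite (_ : (1 - (size s).+1%:R^-1) / (size s)%:R = (size s).+1%:R^-1); last first.
  by rewrite -[X in X - _](divff n0) -[X in _ - X]div1r -mulrBl -[X in X - 1]natr1 addrK mulrAC divff// div1r.
by apply; rewrite invr_ge0 ler0n invf_le1 ?ltr0n// ler1n.
Qed.

(** By convexity [K] contains the image of [box c r] under the homothety of centre [x] and ratio
    [t], and [y] lies in that smaller cube: the last hypothesis bounds its distance to the centre of
    the cube. *)
Lemma segment_closed_fatten K c r t x y : segment_closed K -> box c r `<=` K ->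
  0 < t <= 1 -> K x ->
  (forall i, `|y 0 i - ((1 - t) * x 0 i + t * (c 0 i + r / 2))| <= t * (r / 2)) -> K y.
Proof.
move=> cK bK /andP[t0 t1] Kx hy.
have -> : y = (1 - t) *: x + t *: (t^-1 *: (y - (1 - t) *: x)).
  by rewrite scalerA mulfV ?gt_eqF// scale1r addrC subrK.
apply: cK => //; last by rewrite (ltW t0).
apply: bK => i; rewrite !mxE; have := hy i; rewrite ler_norml => /andP[h1 h2].
rewrite mulrC ler_pdivlMr// ler_pdivrMr//.
by apply/andP; split; lra.
Qed.

Lemma vol_contract A K t x : coord_bounded K -> 0 < t ->
  (forall y, A y -> K (t *: y + x)) -> t ^+ p * vol A <= vol K.
Proof.
move=> bK t0 AK; rewrite -(vol_affine x A t0); apply: vol_sub => // _ [y Ay <-].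
exact: AK.
Qed.

Hypothesis p0 : (0 < p)%N.

(** Count the cubes of mesh [h] that meet [A] and [A'], and the cubes of mesh [h / 2] contained in
    the midpoint set. Points of the two larger cubes are only known up to [h], which is why the
    midpoint set is fattened by [h]. *)
Lemma vol_midpoints A A' (h : R) : coord_bounded A -> coord_bounded A' -> 0 < h ->
  vol A * vol A' <= (vol [set z : 'rV[R]_p | exists x y, [/\ A x, A' y &
    forall i, `|z 0 i - (x 0 i + y 0 i) / 2| <= h]]) ^+ 2.
Proof.
move=> bA bA' h0; set Z := mkset _.
have [M M0 AM] := coord_bounded_sub_box (coord_boundedU bA bA').
have bZ : coord_bounded Z.
  exists (M + h) => z i [x [y [Ax A'y /(_ i)]]].
  have := AM x (or_introl Ax) i; have := AM y (or_intror A'y) i; rewrite !mxE => /andP[? ?] /andP[? ?].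
  by rewrite !ler_norml => /andP[? ?]; apply/andP; split; lra.
pose B := (Num.trunc (2 * M / h)).+1.
have hB : 2 * M <= h * B%:R.
  rewrite -ler_pdivrMl// mulrC ltW//.
  by have /andP[] := @truncn_itv R (2 * M / h) (divr_ge0 (mulr_ge0 (ler0n R 2) (ltW M0)) (ltW h0)).
pose o : 'rV[R]_p := const_mx (- M).
have AB X : X `<=` A `|` A' ->
    X `<=` cells o h (B := B) [pred x | `[< exists y, X y /\ box (grid_point o h (natv x)) h y >]].
  move=> XA y Xy; have [|x _ yx] := @box_sub_cells R p o h B h0 isT y.
    by move=> i; have /andP[-> /le_trans] := AM _ (XA _ Xy) i; apply; rewrite lerD2l.
  by exists x => //; apply/asboolP; exists y.
pose f X (x : 'rV[nat]_p) : nat := `[< exists y, X y /\ box (grid_point o h x) h y >].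
pose H (z : 'rV[nat]_p) : R := (`[< box (grid_point o (h / 2) z) (h / 2) `<=` Z >])%:R.
have H0 z : 0 <= H z by [].
have fgH (x y z : 'rV[nat]_p) :
    (forall i, z ord0 i = (x ord0 i + y ord0 i)%N \/ z ord0 i = (x ord0 i + y ord0 i).+1) ->
    (f A x * f A' y)%:R <= H z ^+ 2.
  move=> hz; rewrite /f; case: asboolP => [[a [Aa ax]]|_]; last by rewrite sqr_ge0.
  case: asboolP => [[b [A'b bx]]|_]; last by rewrite sqr_ge0.
  rewrite /H; case: asboolP => [_|[]]; first by rewrite expr1n.
  move=> w wz; exists a, b; split => // i.
  have := wz i; have := ax i; have := bx i; rewrite !mxE.
  have : h / 2 * (x ord0 i + y ord0 i)%:R <= h / 2 * (z ord0 i)%:R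
      <= h / 2 * (x ord0 i + y ord0 i)%:R + h / 2.
    rewrite -[X in _ + X]mulr1 -mulrDr natr1 !ler_pM2l ?divr_gt0// !ler_nat.
    by case: (hz i) => ->; rewrite leqnn leqnSn.
  rewrite natrD; move: (x ord0 i)%:R (y ord0 i)%:R (z ord0 i)%:R => X Y W.
  move=> /andP[? ?] /andP[? ?] /andP[? ?] /andP[? ?].
  rewrite ler_norml; apply/andP; split; lra.
have := @prekopa_leindler_grid R B p (f A) (f A') H H0 fgH.
have sumf X : (\sum_(x : 'rV['I_B]_p) f X (natv x) =
    #|[pred x : 'rV['I_B]_p | `[< exists y, X y /\ box (grid_point o h (natv x)) h y >]]|)%N.
  by rewrite -sum1_card [RHS]big_mkcond; apply: eq_bigr => x _; rewrite inE /f; case: asboolP.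
rewrite !sumf; set N := #|_|; set N' := #|_|.
have -> : \sum_(z : 'rV['I_(B + B)]_p) H (natv z) =
    #|[pred z : 'rV['I_(B + B)]_p | `[< box (grid_point o (h / 2) (natv z)) (h / 2) `<=` Z >]]|%:R.
  rewrite -sum1_card natr_sum [RHS]big_mkcond; apply: eq_bigr => x _.
  by rewrite inE /H; case: asboolP.
set E := #|_| => le1.
have vA : vol A <= h ^+ p * N%:R by apply: (vol_le_cells p0 h0 (AB A (@subsetUl _ _ _))).
have vA' : vol A' <= h ^+ p * N'%:R by apply: (vol_le_cells p0 h0 (AB A' (@subsetUr _ _ _))).
have vZ : (h / 2) ^+ p * E%:R <= vol Z.
  apply: (@vol_ge_cells _ _ p0 o) => //; first by rewrite divr_gt0.
  by move=> y [x /asboolP xZ yx]; exact: xZ.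
apply: (@le_trans _ _ (((h / 2) ^+ p * E%:R) ^+ 2)); last first.
  by rewrite lerXn2r ?nnegrE ?vol_ge0// mulr_ge0// exprn_ge0// divr_ge0// ltW.
rewrite exprMn; apply: (@le_trans _ _ (h ^+ p * N%:R * (h ^+ p * N'%:R))).
  by rewrite ler_pM// vol_ge0.
apply: le_trans (_ : ((h / 2) ^+ p) ^+ 2 * (4 ^+ p * (N * N')%:R) <= _); last first.
  by rewrite ler_wpM2l// sqr_ge0.
rewrite [leRHS]mulrA [_ ^+ p ^+ 2]exprAC -[_ ^+ p * 4 ^+ p]exprMn natrM.
by rewrite (_ : (h / 2) ^+ 2 * 4 = h * h) ?exprMn 1?mulrACA//; field.
Qed.

(** The multiplicative Brunn-Minkowski inequality. Contracting by [1 - t] towards the centre of the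
    cube in [K] brings the midpoint set, fattened by [t * (r / 2)], back into [K]; then [t] tends to
    0. *)
Lemma vol_midpoint_convex K A A' c r : segment_closed K -> coord_bounded K ->
  0 < r -> box c r `<=` K -> coord_bounded A -> coord_bounded A' ->
  (forall x y, A x -> A' y -> K (2^-1 *: (x + y))) -> vol A * vol A' <= (vol K) ^+ 2.
Proof.
move=> cK bK r0 bcK bA bA' AK.
apply: (@le_onem_expr_limit _ (2 * p)%N); first by rewrite mulr_ge0 ?vol_ge0.
move=> t /andP[t0 t1]; have h0 : 0 < t * (r / 2) by rewrite mulr_gt0 ?divr_gt0.
have := vol_midpoints bA bA' h0; set Z := mkset _ => hZ.
have ZK : (1 - t) ^+ p * vol Z <= vol K.
  apply: (@vol_contract _ _ _ (t *: (c + const_mx (r / 2)))) => //; first by rewrite subr_gt0.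
  move=> z [x [y [Ax A'y hz]]].
  apply: (@segment_closed_fatten K c r t (2^-1 *: (x + y))) => //; first by rewrite t0 ltW.
    exact: AK.
  move=> i; rewrite !mxE.
  have -> : (1 - t) * z 0 i + t * (c 0 i + r / 2) -
      ((1 - t) * (2^-1 * (x 0 i + y 0 i)) + t * (c 0 i + r / 2)) =
      (1 - t) * (z 0 i - (x 0 i + y 0 i) / 2) by ring.
  rewrite normrM ger0_norm ?subr_ge0 ?(ltW t1)//.
  apply: le_trans (ler_wpM2l _ (hz i)) _; first by rewrite subr_ge0 ltW.
  by rewrite ler_piMl ?(ltW h0)// gerBl ltW.
rewrite mulnC exprM; apply: le_trans (ler_wpM2l (sqr_ge0 _) hZ) _.
rewrite -exprMn lerXn2r ?nnegrE ?vol_ge0// mulr_ge0 ?vol_ge0// exprn_ge0// subr_ge0 ltW//.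
Qed.

End ConvexSets.

(** * Caps of a convex body *)
Definition cap {R : realType} {p : nat} (C : set 'rV[R]_p) (u : 'rV[R]_p) (t : R) : set 'rV[R]_p :=
  [set y | C y /\ t <= dotv u y].

Section Caps.
Context {R : realType} {p : nat}.
Variables (C : set 'rV[R]_p) (c : 'rV[R]_p) (r : R).
Hypotheses (p0 : (0 < p)%N) (segC : segment_closed C) (bndC : coord_bounded C)
  (r0 : 0 < r) (boxC : box c r `<=` C).

Lemma cap_sub u t : cap C u t `<=` C. Proof. by move=> y []. Qed.

Lemma cap_bounded u t : coord_bounded (cap C u t).
Proof. exact: coord_boundedS (@cap_sub u t) bndC. Qed.

Lemma vol_cap_anti u s t : s <= t -> vol (cap C u t) <= vol (cap C u s).
Proof.
move=> st; apply: vol_sub; first exact: cap_bounded.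
by move=> y [Cy ty]; split=> //; exact: le_trans ty.
Qed.

Lemma vol_cap_le u t : vol (cap C u t) <= vol C.
Proof. by apply: vol_sub => //; exact: cap_sub. Qed.

Lemma vol_body_gt0 : 0 < vol C.
Proof.
by apply: lt_le_trans (vol_sub bndC boxC); rewrite vol_box// exprn_gt0.
Qed.

Section Direction.
Variables (u a b : 'rV[R]_p).
Hypotheses (Ca : C a) (Cb : C b) (ua : forall y, C y -> dotv u a <= dotv u y)
  (ub : forall y, C y -> dotv u y <= dotv u b).
Local Notation w := (dotv u b - dotv u a).

Lemma width_ge_osc x y : C x -> C y -> dotv u x - dotv u y <= w.
Proof. by move=> Cx Cy; rewrite lerB// ?ub ?ua. Qed.

Lemma width_gt0 : u != 0 -> 0 < w.
Proof.
move=> u0; have [i ui] : exists i, u 0 i != 0.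
  apply/existsP; apply: contraNT u0; rewrite negb_exists => /forallP h.
  by apply/eqP/rowP => i; rewrite mxE; apply/eqP; have := h i; rewrite negbK.
pose x := c + r *: delta_mx 0 i.
have xc : dotv u x - dotv u c = r * u 0 i.
  rewrite -dotvBr /x addrAC subrr add0r dotvZr; congr (_ * _).
  rewrite /dotv (bigD1 i)//= mxE !eqxx mulr1 big1 ?addr0// => j ji.
  by rewrite mxE (negPf ji) andbF mulr0.
have Cc : C c by apply: boxC => j; rewrite lexx lerDl ltW.
have Cx : C x.
  apply: boxC => j; rewrite !mxE lerDl lerD2l.
  by case: (j == i); rewrite ?mulr1 ?mulr0 (ltW r0) lexx.
have := width_ge_osc Cx Cc; rewrite xc.
have := width_ge_osc Cc Cx; rewrite -opprB xc => h1 h2.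
rewrite lt_neqAle subr_ge0 ua// andbT; apply: contraNneq ui => w0.
have : r * u 0 i == 0 by rewrite eq_le; apply/andP; split; lra.
by rewrite mulf_eq0 gt_eqF.
Qed.

(** The homothety of ratio [1 - theta] towards the maximizer [b] keeps the body in itself and lifts
    level [t] by [theta * (dotv u b - t)]. *)
Lemma vol_cap_contract (theta e t : R) : 0 <= theta < 1 -> e <= theta * (dotv u b - t) ->
  (1 - theta) ^+ p * vol (cap C u t) <= vol (cap C u (t + e)).
Proof.
move=> /andP[th0 th1] he.
apply: (@vol_contract _ _ _ _ _ (theta *: b)) => //; rewrite ?subr_gt0//; first exact: cap_bounded.
move=> y [Cy ty]; split; first by apply: segC => //; rewrite th0 ltW.
rewrite dotvDr !dotvZr.
have : (1 - theta) * t <= (1 - theta) * dotv u y by rewrite ler_wpM2l// subr_ge0 ltW.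
by move: he; lra.
Qed.

Lemma cap_full t : t <= dotv u a -> cap C u t = C.
Proof.
move=> ta; apply/seteqP; split=> [y []//|y Cy]; split=> //.
exact: le_trans ta (ua Cy).
Qed.

Lemma cap_log_concave s t : 0 < w ->
  vol (cap C u s) * vol (cap C u t) <= vol (cap C u ((s + t) / 2)) ^+ 2.
Proof.
move=> w0; set m := (s + t) / 2.
have cap0 v : dotv u b < v -> vol (cap C u v) = 0.
  move=> bv; have -> : cap C u v = set0.
    by apply/seteqP; split=> // y [/ub yb vy]; move: (lt_le_trans bv (le_trans vy yb)); rewrite ltxx.
  by rewrite /vol prehausdorff0 mul0r.
(* Brunn-Minkowski needs a cube inside the middle cap. When [m] is at or above the maximum of [u],
   either one of the two caps is empty or both levels equal [m]. *)
have [mb|bm] := ltP m (dotv u b); last first.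
  have [sb|bs] := ltP (dotv u b) s; first by rewrite cap0// mul0r sqr_ge0.
  have [tb|bt] := ltP (dotv u b) t; first by rewrite [X in _ * X]cap0// mulr0 sqr_ge0.
  by have [-> ->] : s = m /\ t = m by move: bm bs bt; rewrite /m; split; lra.
(* The copy of [box c r] shrunk by [th] towards [b] lies above level [dotv u b - th * w], which is
   at least [m]. *)
set th := Num.min 1 ((dotv u b - m) / w).
have th0 : 0 < th by rewrite lt_min ltr01 divr_gt0// subr_gt0.
have th1 : th <= 1 by rewrite ge_min lexx.
have thw : th * w <= dotv u b - m by rewrite -ler_pdivlMr// ge_min lexx orbT.
apply: (@vol_midpoint_convex _ _ p0 _ _ _ ((1 - th) *: b + th *: c) (th * r)).
- move=> x y v [Cx mx] [Cy my] v01; split; first exact: segC.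
  have /andP[v0 v1] := v01; rewrite dotvDr !dotvZr.
  have : (1 - v) * m <= (1 - v) * dotv u x by rewrite ler_wpM2l// subr_ge0.
  by have := ler_wpM2l v0 my; lra.
- exact: cap_bounded.
- by rewrite mulr_gt0.
- move=> y ybox.
  have Cz : C (th^-1 *: (y - (1 - th) *: b)).
    apply: boxC => i; have := ybox i; rewrite !mxE => /andP[y1 y2].
    rewrite mulrC ler_pdivlMr// ler_pdivrMr//; apply/andP; split; lra.
  have yE : y = (1 - th) *: b + th *: (th^-1 *: (y - (1 - th) *: b)).
    by rewrite scalerA mulfV ?gt_eqF// scale1r addrC subrK.
  split; first by rewrite yE; apply: segC => //; rewrite (ltW th0).
  rewrite yE dotvDr !dotvZr.
  have := ler_wpM2l (ltW th0) (ua Cz); rewrite dotvZr; lra.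
- exact: cap_bounded.
- exact: cap_bounded.
- move=> x y [Cx sx] [Cy ty]; split.
    have := segC Cx Cy (t := 2^-1); rewrite scalerDr (_ : 1 - 2^-1 = 2^-1); last by lra.
    by apply; apply/andP; split; lra.
  by rewrite dotvZr dotvDr /m; lra.
Qed.

End Direction.

(** Contract, towards the far end of the body, the part lying on the side where at least about half
    of the width remains; a ratio [1 - O(e)] then crosses the slab and costs [O(p e)] of the
    volume. *)
Lemma vol_cap_slab u a b e t : C a -> C b -> (forall y, C y -> dotv u a <= dotv u y) ->
  (forall y, C y -> dotv u y <= dotv u b) -> u != 0 -> 0 < e ->
  vol (cap C u t) - vol (cap C u (t + e * (dotv u b - dotv u a))) <= 4 * p%:R * e * vol C.
Proof.
move=> Ca Cb ua ub u0 e0; have w0 : 0 < dotv u b - dotv u a by apply: width_gt0.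
set w := dotv u b - dotv u a in w0 *.
have volC := vol_ge0 C.
have p1 : 1 <= p%:R :> R by rewrite ler1n.
have [e4|e4] := leP 1 (4 * e).
  apply: (@le_trans _ _ (vol C)).
    by rewrite lerBlDr (le_trans (vol_cap_le u t))// lerDl vol_ge0.
  by rewrite ler_peMl// mulrAC (le_trans e4)// ler_peMr//; lra.
have [tb|bt] := leP (w / 2) (dotv u b - t).
  have th01 : 0 <= 2 * e < 1 by apply/andP; split; lra.
  have hth : e * w <= 2 * e * (dotv u b - t) by nra.
  have := vol_cap_contract Cb th01 hth.
  have th01' : 0 <= 2 * e <= 1 by apply/andP; split; lra.
  have := ler_wpM2r (vol_ge0 (cap C u t)) (onem_expr_ge p th01').
  move=> h1 h2; have := le_trans h1 h2.
  have : p%:R * e * vol (cap C u t) <= p%:R * e * vol C.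
    by rewrite ler_wpM2l ?vol_cap_le// mulr_ge0 ?(ltW e0)//; lra.
  have := mulr_ge0 (mulr_ge0 (ler0n R p) (ltW e0)) volC.
  by lra.
(* For [t] in the upper half, the part below [t + e * w] is contracted towards [a]. It is moved by
   [2 * e * w] rather than [e * w], so that its image [D2] stays at a positive distance from the cap
   at [t] and the two volumes add up inside [C]. *)
have una y : C y -> dotv (- u) y <= dotv (- u) a by move=> Cy; rewrite !dotvNl lerN2 ua.
have th01 : 0 <= 4 * e < 1 by apply/andP; split; lra.
have hth : 2 * e * w <= 4 * e * (dotv (- u) a - (- (t + e * w))).
  have h : w / 2 <= t - dotv u a by move: bt; rewrite /w; lra.
  have := ler_wpM2l (ltW e0) h; have := mulr_ge0 (ltW e0) (mulr_ge0 (ltW e0) (ltW w0)).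
  by rewrite dotvNl; lra.
have := vol_cap_contract Ca th01 hth.
have -> : - (t + e * w) + 2 * e * w = - (t - e * w) by ring.
set D1 := cap C (- u) (- (t + e * w)); set D2 := cap C (- u) _ => h1.
have th01' : 0 <= 4 * e <= 1 by apply/andP; split; lra.
have h2 := le_trans (ler_wpM2r (vol_ge0 D1) (onem_expr_ge p th01')) h1.
have : vol (cap C u t) + vol D2 <= vol C.
  pose su := \sum_i `|u 0 i| + 1.
  have su0 : 0 < su by rewrite ltr_wpDl// sumr_ge0.
  apply: le_trans (vol_sub bndC (_ : cap C u t `|` D2 `<=` C)); last by move=> y [[]|[]].
  apply: (@vol_separated _ _ (e * w / su)); [exact: cap_bounded|exact: cap_bounded| |].
    by rewrite divr_gt0// mulr_gt0.
  move=> x y [_ tx] [_]; rewrite dotvNl lerN2 => ty.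
  rewrite ler_pdivrMr// mulrC; apply: (@le_trans _ _ (dotv u (x - y))); first by rewrite dotvBr; lra.
  apply: le_trans (dotv_le_enorm _ _) _; rewrite mulrC ler_wpM2l ?enorm_ge0//.
  by rewrite lerDl.
have : vol C <= vol (cap C u (t + e * w)) + vol D1.
  apply: le_trans (volU_le (cap_bounded _ _) (cap_bounded _ _)).
  apply: vol_sub; first by apply: coord_boundedU; exact: cap_bounded.
  move=> y Cy; have [h|h] := leP (t + e * w) (dotv u y); first by left.
  by right; split=> //; rewrite dotvNl lerN2 ltW.
have : p%:R * e * vol D1 <= p%:R * e * vol C.
  by rewrite ler_wpM2l ?vol_cap_le// mulr_ge0 ?(ltW e0)//; lra.
by lra.
Qed.

End Caps.

(** * An approximate Grünbaum point *)
(** The counterpart of [count_le_real]: it bounds an average of levels from above by the numbers of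
    points lying above each level. *)
Lemma le_count_levels (R : realType) (L : nat) (z : R) : z <= L%:R + 1 ->
  z <= 1 + \sum_(i < L) (i.+1%:R <= z)%R%:R.
Proof.
elim: L => [|L IH] zL; first by rewrite big_ord0; lra.
rewrite big_ord_recr /=; have [zl|lz] := leP z (L%:R + 1).
  by have := IH zl; have : 0 <= (L.+1%:R <= z)%R%:R :> R by []; lra.
have -> : \sum_(i < L) (i.+1%:R <= z)%R%:R = L%:R :> R.
  rewrite (eq_bigr (fun=> 1)); first by rewrite sumr_const card_ord.
  move=> i _; rewrite (_ : _ <= z) //; apply: le_trans (ltW lz).
  by rewrite natr1 ler_nat ltnW// ltnS.
rewrite (_ : (L.+1%:R <= z) = true) /=; last by rewrite -natr1 ltW.
by move: zL; rewrite -natr1; lra.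
Qed.

Section ApproximateBarycenter.
Context {R : realType} {p : nat}.
Variables (C : set 'rV[R]_p) (c : 'rV[R]_p) (r : R).
Hypotheses (p0 : (0 < p)%N) (segC : segment_closed C) (bndC : coord_bounded C)
  (r0 : 0 < r) (boxC : box c r `<=` C).

(* The point is the mean of the corners of the grid cubes contained in [C]. *)
Lemma grunbaum_approx (gamma : R) : 0 < gamma -> exists2 g, C g &
  forall u a b, C a -> C b -> (forall y, C y -> dotv u a <= dotv u y) ->
    (forall y, C y -> dotv u y <= dotv u b) -> u != 0 ->
    ((expR 1)^-1 - gamma) * vol C <= vol (cap C u (dotv u g)).
Proof.
have Cq : C (c + const_mx (r / 2)).
  by apply: boxC => i; rewrite !mxE; move: r0 => ?; apply/andP; split; lra.
move=> gamma0; have p1 : 1 <= p%:R :> R by rewrite ler1n.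
have volC := vol_body_gt0 p0 bndC r0 boxC.
pose K : R := 8 * expR 5.
have K0 : 0 < K by rewrite mulr_gt0 ?expR_gt0.
(* Slabs of relative width [e] lose at most [beta = 4 p e]. The first bound makes the final error
   [8 * expR 5 * beta] at most [gamma], the second gives [20 * beta < 1]. *)
pose e := Num.min (gamma / (4 * p%:R * K)) (81 * p%:R)^-1.
have pp : 0 < p%:R :> R by lra.
have e0 : 0 < e by rewrite lt_min divr_gt0 ?invr_gt0 ?mulr_gt0.
have eK : K * (4 * p%:R * e) <= gamma.
  have : e <= gamma / (4 * p%:R * K) by rewrite ge_min lexx.
  by rewrite ler_pdivlMr ?mulr_gt0//; lra.
have e81 : 81 * p%:R * e <= 1.
  have : e <= (81 * p%:R)^-1 by rewrite ge_min lexx orbT.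
  by rewrite -div1r ler_pdivlMr ?mulr_gt0//; lra.
have e1 : e <= 1 / 81 by rewrite ler_pdivlMr//; nra.
(* Each of the [J + J] level counts below carries an error [p * eta = e / 4]; as [J * e <= 2], these
   errors add up to at most 1. *)
pose eta := e / (4 * p%:R).
have p40 : 0 < 4 * p%:R :> R by rewrite mulr_gt0.
have eta0 : 0 < eta by rewrite divr_gt0.
have etap : p%:R * eta = e / 4 by rewrite /eta; field; rewrite gt_eqF.
have etae : eta <= e by rewrite ler_pdivrMr//; nra.
pose h := eta * (r / 2); have h0 : 0 < h by rewrite mulr_gt0 ?divr_gt0.
have [M M0 CM] := coord_bounded_sub_box bndC.
pose B := (Num.trunc (2 * M / h)).+1.
have hB : 2 * M <= h * B%:R.
  rewrite -ler_pdivrMl// mulrC ltW//.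
  by have /andP[] := @truncn_itv R (2 * M / h) (divr_ge0 (mulr_ge0 (ler0n R 2) (ltW M0)) (ltW h0)).
pose o : 'rV[R]_p := const_mx (- M).
pose G (x : 'rV['I_B]_p) := grid_point o h (natv x).
pose X := [pred x : 'rV['I_B]_p | `[< box (G x) h `<=` C >]].
have GC x : X x -> C (G x).
  by move=> /asboolP; apply=> i; rewrite lexx lerDl ltW.
(* Contract [C] by [1 - eta] towards the centre of its cube: every grid cube that meets the image
   lies in [C], because [h] is [eta * (r / 2)]. *)
have volX : (1 - eta) ^+ p * vol C <= h ^+ p * #|X|%:R.
  have eta1 : 0 < 1 - eta by lra.
  rewrite -(vol_affine (eta *: (c + const_mx (r / 2))) C eta1).
  apply: (@vol_le_cells _ _ p0 o h B X) => // _ [y Cy <-].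
  set z := (X in cells _ _ _ X).
  have Cz : C z.
    by apply: segC => //; rewrite (ltW eta0); lra.
  have [|x _ zx] := @box_sub_cells R p o h B h0 isT z.
    by move=> i; have /andP[-> /le_trans] := CM _ Cz i; apply; rewrite lerD2l.
  exists x => //; apply/asboolP => v vx.
  apply: (segment_closed_fatten segC boxC _ Cy (t := eta)); first by rewrite eta0; lra.
  move=> i; have /andP[v1 v2] := vx i; have /andP[z1 z2] := zx i.
  have <- : z 0 i = (1 - eta) * y 0 i + eta * (c 0 i + r / 2) by rewrite !mxE.
  by rewrite ler_norml -/h; apply/andP; split; move: v1 v2 z1 z2; rewrite /G; lra.
have X0 : 0 < #|X|%:R :> R.
  have : 0 < (1 - eta) ^+ p * vol C by rewrite mulr_gt0// exprn_gt0//; lra.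
  by move=> /lt_le_trans/(_ volX); rewrite pmulr_rgt0// exprn_gt0.
pose g := #|X|%:R^-1 *: \sum_(x | X x) G x.
exists g; first by apply: segment_closed_mean => //; rewrite -(ltr0n R).
move=> u a b Ca Cb ua ub u0.
have Cg : C g by apply: segment_closed_mean => //; rewrite -(ltr0n R).
have w0 : 0 < dotv u b - dotv u a by apply: (width_gt0 r0 boxC).
set w := dotv u b - dotv u a in w0.
have osc x y : C x -> C y -> dotv u x - dotv u y <= w by move=> Cx Cy; exact: (lerB (ub _ Cx) (ua _ Cy)).
set t0 := dotv u g.
have te0 : 0 < e * w by rewrite mulr_gt0.
pose J := (Num.trunc e^-1).+1.
have /andP[J1 J2] : J%:R - 1 <= e^-1 < J%:R.
  by rewrite -{1}natr1 addrK; apply: truncn_itv; rewrite invr_ge0 ltW.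
have Je : 1 <= J%:R * e by rewrite -ler_pdivrMr// div1r ltW.
have Je2 : J%:R * e <= 2 by move: J1; rewrite -div1r ler_pdivlMr//; lra.
(* Spacing [e * w] with [J] steps on either side of [t0]; as [J * e >= 1], the levels span the whole
   range of [u] on [C], and [lev J] is [t0]. *)
pose lev (i : nat) := t0 + (i%:R - J%:R) * (e * w).
have levS i : lev i.+1 = lev i + e * w by rewrite /lev -natr1; ring.
pose f i := vol (cap C u (lev i)) / vol C.
pose N i := #|[pred x | X x && (lev i <= dotv u (G x))]|.
(* Within a cell [u] drops by at most [eta * w <= e * w] below its value at the corner: a
   displacement in a cell is [eta] times a displacement from the centre of [box c r] to another of
   its points. *)
have hN i : h ^+ p * (N i.+1)%:R <= vol (cap C u (lev i)).
  apply: (@vol_ge_cells _ _ p0 o h B) => //; first exact: cap_bounded.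
  move=> y [x /andP[/asboolP Xx hx] yx]; split; first exact: Xx.
  pose v := eta^-1 *: (y - G x).
  have hv j : `|v 0 j| <= r / 2.
    have /andP[] := yx j; rewrite !mxE => y1 y2.
    by rewrite normrM ger0_norm ?invr_ge0 ?(ltW eta0)// ler_pdivrMl// -/h ler_norml; apply/andP; split; lra.
  have q2 : C (c + const_mx (r / 2) + v).
    apply: boxC => j; have := hv j; rewrite ler_norml !mxE.
    by move: (v 0 j) (c 0 j) => s t; clear=> /andP[? ?]; apply/andP; split; lra.
  have := osc _ _ Cq q2; rewrite -dotvBr opprD addrA subrr add0r dotvNr dotvZr dotvBr.
  move=> h1; have {}h1 := ler_wpM2l (ltW eta0) h1.
  have h2 : eta * w <= e * w by rewrite ler_wpM2r// ltW.
  move: h1; rewrite mulrN mulrA mulfV ?gt_eqF// mul1r => h1.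
  by move: hx; rewrite levS; lra.
have NX i : (N i <= #|X|)%N.
  by apply: subset_leq_card; apply/fintype.subsetP => x /andP[].
have fN i : (N i.+1)%:R <= #|X|%:R * (f i + p%:R * eta).
  have hp : 0 < h ^+ p by rewrite exprn_gt0.
  have fi0 : 0 <= f i by rewrite divr_ge0 ?vol_ge0.
  have e01 : 0 <= eta <= 1 by rewrite ltW//=; lra.
  have le1 : (1 - eta) ^+ p * (N i.+1)%:R <= #|X|%:R * f i.
    rewrite -(ler_pM2l hp) mulrCA.
    apply: (@le_trans _ _ ((1 - eta) ^+ p * (f i * vol C))).
      by rewrite ler_wpM2l ?exprn_ge0//; [lra|rewrite divfK ?gt_eqF].
    have := ler_wpM2l fi0 volX.
    by rewrite (mulrCA (f i) (_ ^+ p)) (mulrCA (f i) (h ^+ p)) [f i * #|X|%:R]mulrC.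
  have := le_trans (ler_wpM2r (ler0n R (N i.+1)) (onem_expr_ge p e01)) le1.
  have : p%:R * eta * (N i.+1)%:R <= p%:R * eta * #|X|%:R.
    by rewrite ler_wpM2l ?ler_nat ?NX// mulr_ge0 ?ltW.
  by lra.
have fsum : J%:R - 2 <= \sum_(i < J + J) f i.
  (* Measured in steps of [e * w], the levels of the corners average to [J], because [g] is their
     mean. *)
  have mean : \sum_(x | X x) ((dotv u (G x) - t0) / (e * w) + J%:R) = #|X|%:R * J%:R.
    rewrite big_split /= sumr_const -mulr_suml sumrB sumr_const.
    have -> : \sum_(x | X x) dotv u (G x) = #|X|%:R * t0.
      by rewrite /t0 /g dotvZr dotv_sumr mulrA mulfV ?mul1r// gt_eqF.
    by rewrite -[t0 *+ _]mulr_natl subrr mul0r add0r -[LHS]mulr_natl.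
  have bound : #|X|%:R * J%:R <= #|X|%:R + \sum_(i < J + J) (N i.+1)%:R :> R.
    rewrite -mean.
    have -> : #|X|%:R + \sum_(i < J + J) (N i.+1)%:R =
        \sum_(x | X x) (1 + \sum_(i < J + J) (lev i.+1 <= dotv u (G x))%R%:R) :> R.
      rewrite big_split /= sumr_const; congr (_ + _); rewrite exchange_big /=.
      apply: eq_bigr => i _; rewrite /N -sum1_card natr_sum big_mkcondr /=.
      by apply: eq_bigr => x _; case: (_ <= _).
    apply: ler_sum => x Xx; set z := _ / _ + _.
    have -> : \sum_(i < J + J) (lev i.+1 <= dotv u (G x))%R%:R =
        \sum_(i < J + J) (i.+1%:R <= z)%R%:R :> R.
      apply: eq_bigr => i _; congr (nat_of_bool _)%:R.
      by rewrite /lev /z -lerBlDr ler_pdivlMr// -lerBrDl.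
    apply: le_count_levels; rewrite natrD /z -lerBrDr ler_pdivrMr//.
    have := osc _ _ (GC x Xx) Cg; rewrite -/t0.
    have : w <= J%:R * e * w by rewrite ler_peMl// ltW.
    lra.
  have : #|X|%:R * J%:R <= #|X|%:R * (1 + \sum_(i < J + J) (f i + p%:R * eta)) :> R.
    apply: le_trans bound _; rewrite mulrDr mulr1 lerD2l mulr_sumr.
    by apply: ler_sum => i _; exact: fN.
  rewrite ler_pM2l// big_split /= sumr_const card_ord -(mulr_natl (p%:R * eta)) natrD etap.
  by lra.
have := @log_concave_grunbaum R f J (4 * p%:R * e).
have fJ : f J = vol (cap C u t0) / vol C by rewrite /f /lev subrr mul0r addr0.
rewrite fJ ler_pdivlMr// => main.
apply: le_trans (main _ _ _ _ _ _ _ _) => //.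
- by rewrite ler_wpM2r ?(ltW volC)// lerD2l lerN2.
- move=> i; rewrite divr_ge0 ?vol_ge0//= ler_pdivrMr// mul1r; exact: vol_cap_le.
- move=> i; rewrite ler_wpM2r ?invr_ge0 ?(ltW volC)// vol_cap_anti// levS lerDl ltW//.
- move=> i; rewrite /f mulrACA -[(vol C)^-1 * _]expr2 exprMn ler_wpM2r ?sqr_ge0//.
  have := @cap_log_concave _ _ C c r p0 segC bndC r0 boxC u a b Cb ua ub (lev i) (lev i.+2) w0.
  by rewrite !levS (_ : (lev i + (lev i + e * w + e * w)) / 2 = lev i + e * w)//; field.
- move=> i; rewrite /f -mulrBl ler_pdivrMr// levS.
  by apply: (vol_cap_slab p0 segC bndC r0 boxC).
- rewrite /f (cap_full ua) ?divff ?gt_eqF//.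
  have := ub g Cg; rewrite -/t0 /lev sub0r => h1.
  have : w <= J%:R * e * w by rewrite ler_peMl// ltW.
  by rewrite /w; lra.
- by lra.
Qed.

End ApproximateBarycenter.

(** * Mixed-integer slices *)
Lemma grid_point_row (R : realType) (n d : nat) (o1 : 'rV[R]_n) (o2 : 'rV[R]_d) (h : R) (B : nat)
    (i : 'rV['I_B]_n) (y : 'rV['I_B]_d) :
  grid_point (row_mx o1 o2) h (natv (row_mx i y)) =
  row_mx (grid_point o1 h (natv i)) (grid_point o2 h (natv y)).
Proof.
apply/rowP => k; rewrite -(splitK k); case: (fintype.split k) => l /=.
  rewrite [RHS]row_mxEl [LHS]mxE [RHS]mxE row_mxEl; congr (_ + _ * _%:R).
  by rewrite [LHS]mxE [RHS]mxE row_mxEl.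
rewrite [RHS]row_mxEr [LHS]mxE [RHS]mxE row_mxEr; congr (_ + _ * _%:R).
by rewrite [LHS]mxE [RHS]mxE row_mxEr.
Qed.

Lemma box_row (R : realType) (n d : nat) (a x : 'rV[R]_n) (b y : 'rV[R]_d) (h : R) :
  box (row_mx a b) h (row_mx x y) <-> box a h x /\ box b h y.
Proof.
split=> [H|[ax by_] k].
  by split=> k; [have := H (lshift d k); rewrite !row_mxEl|have := H (rshift n k); rewrite !row_mxEr].
by rewrite -(splitK k); case: (fintype.split k) => l /=; rewrite ?row_mxEl ?row_mxEr.
Qed.

(** The contraction about [x] maps [box c r] to a cube in [K] of half-side [delta * (r / 2)]; a cell
    of no larger mesh that contains the centre of this cube is inside it. *)
Lemma cell_sub_contraction (R : realType) (p : nat) (C K : set 'rV[R]_p) (c x g : 'rV[R]_p)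
    (r h delta : R) :
  box c r `<=` C -> 0 < delta -> h <= delta * (r / 2) ->
  (forall x', C x' -> K ((1 - delta) *: x + delta *: x')) ->
  box g h ((1 - delta) *: x + delta *: (c + const_mx (r / 2))) -> box g h `<=` K.
Proof.
move=> boxC delta0 hr xK gx y gy.
have -> : y = (1 - delta) *: x + delta *: (delta^-1 *: (y - (1 - delta) *: x)).
  by rewrite scalerA mulfV ?gt_eqF// scale1r addrC subrK.
apply: xK; apply: boxC => i; have := gy i; have := gx i; rewrite !mxE => /andP[? ?] /andP[? ?].
rewrite mulrC ler_pdivlMr// ler_pdivrMr//; apply/andP; split; lra.
Qed.

Section DivideIndex.
Context {m B : nat}.

Lemma divn_ord_subproof (i : 'I_(m * B)) : (i %/ m < B)%N.
Proof.
case: i => i lt /=; have [m0|m0] := posnP m; first by move: lt; rewrite m0 mul0n.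
by rewrite ltn_divLR// mulnC.
Qed.

Definition divn_ord (i : 'I_(m * B)) : 'I_B := Ordinal (divn_ord_subproof i).

(** Groups the columns of a fine grid by unit cell: each lattice point receives [m ^ n] of them. *)
Lemma sum_div_index (n : nat) (V : nmodType) (F : 'rV['I_B]_n -> V) : (0 < m)%N ->
  \sum_(i : 'rV['I_(m * B)]_n) F (map_mx divn_ord i) = (\sum_z F z) *+ m ^ n.
Proof.
move=> m0; have lt (z : 'I_B) (j : 'I_m) : (z * m + j < m * B)%N.
  apply: (@leq_trans (z.+1 * m)); first by rewrite mulSn addnC ltn_add2r.
  by rewrite mulnC leq_mul2l ltn_ord orbT.
pose f (zj : 'rV['I_B]_n * 'rV['I_m]_n) : 'rV['I_(m * B)]_n :=
  \row_k Ordinal (lt (zj.1 0 k) (zj.2 0 k)).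
have fK : cancel f (fun i => (map_mx divn_ord i, \row_k Ordinal (ltn_pmod (i 0 k : nat) m0))).
  move=> [z j]; congr (_, _); apply/rowP => k; apply: val_inj; rewrite !mxE /=.
    by rewrite divnMDl// divn_small// addn0.
  by rewrite modnMDl modn_small.
have Kf : cancel (fun i => (map_mx divn_ord i, \row_k Ordinal (ltn_pmod (i 0 k : nat) m0))) f.
  by move=> i; apply/rowP => k; apply: val_inj; rewrite /f mxE /= !mxE /= -divn_eq.
rewrite (reindex f) /=; last first.
  by exists (fun i => (map_mx divn_ord i, \row_k Ordinal (ltn_pmod (i 0 k : nat) m0))) => ? _.
transitivity (\sum_(zj : 'rV['I_B]_n * 'rV['I_m]_n) F zj.1).
  by apply: eq_bigr => zj _; have := congr1 fst (fK zj) => /= ->.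
rewrite -(pair_bigA _ (fun z _ => F z)) /= -sumrMnl; apply: eq_bigr => z _.
by rewrite sumr_const card_mx card_ord mul1n.
Qed.

End DivideIndex.

Lemma nat_above (R : realType) (x : R) : exists2 m : nat, (0 < m)%N & x <= m%:R.
Proof.
exists (Num.trunc `|x|).+1 => //; apply: le_trans (ler_norm x) _; apply: ltW.
by have /andP[] := @truncn_itv R `|x| (normr_ge0 _).
Qed.

Section Slices.
Context {R : realType} {n d : nat}.
Implicit Types (A K : set 'rV[R]_(n + d)) (z : 'rV[R]_n).

Definition slice A z : set 'rV[R]_d := [set y | A (row_mx z y)].

Lemma slice_bounded A z : coord_bounded A -> coord_bounded (slice A z).
Proof.
by move=> [M AM]; exists M => y i /(AM _ (rshift n i)); rewrite row_mxEr.
Qed.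

(** Ordinals shifted to the integers from [-L] to [L - 1], a finite range that is large enough once
    the body is bounded by some [M < L]. *)
Definition lattice_point (L : nat) (z : 'rV['I_(L + L)]_n) : 'rV[R]_n :=
  \row_i ((z 0 i)%:R - L%:R).

Variables (C : set 'rV[R]_(n + d)) (c : 'rV[R]_(n + d)) (b : 'rV[R]_n)
  (r rho delta M : R) (L : nat).
Hypotheses (n0 : (0 < n)%N) (d0 : (0 < d)%N) (r0 : 0 < r) (boxC : box c r `<=` C)
  (M0 : 0 < M) (CM : forall x i, C x -> `|x 0 i| <= M) (ML : 2 * M + 1 <= L%:R)
  (projC : box b rho `<=` lsubmx @` C)
  (delta0 : 0 < delta) (delta1 : delta <= 1 / 4) (rhodelta : 1 <= delta * rho).

Let nd0 : (0 < n + d)%N. Proof. by rewrite addn_gt0 n0. Qed.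
Let bndC : coord_bounded C. Proof. by exists M. Qed.
Let onem0 : 0 < 1 - delta. Proof. by move: delta1; lra. Qed.

Let bM i : `|b 0 i| <= M.
Proof.
have rho0 : 0 < rho by rewrite -(pmulr_rgt0 _ delta0) (lt_le_trans ltr01).
have [|x Cx bx] := projC (t := b); first by move=> j; rewrite lexx lerDl ltW.
have := CM (lshift d i) Cx; have := congr1 (fun y : 'rV_n => y 0 i) bx.
by rewrite mxE => <-.
Qed.

Let Cq : C (c + const_mx (r / 2)).
Proof. by apply: boxC => i; rewrite !mxE; move: r0 => ?; apply/andP; split; lra. Qed.

Let db i : `|delta * b 0 i| <= M.
Proof.
rewrite normrM (ger0_norm (ltW delta0)); apply: le_trans (bM i).
by rewrite ler_piMl//; move: delta1; lra.
Qed.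

Let divn_real (m B : nat) (i : 'I_(m * B)) : (0 < m)%N ->
  0 <= (i%:R / m%:R - (divn_ord i)%:R : R) <= 1.
Proof.
move=> m0; have m0' : 0 < m%:R :> R by rewrite ltr0n.
rewrite subr_ge0 lerBlDr ler_pdivlMr// ler_pdivrMr// -natrM mulrDl mul1r -natrM -natrD !ler_nat.
by rewrite leq_trunc_div /=; have := divn_eq i m; have := ltn_pmod i m0; lia.
Qed.

Let card_row (B : nat) (X : pred 'rV['I_B]_(n + d)) :
  (#|X| = \sum_(i : 'rV['I_B]_n) #|[pred y | X (row_mx i y)]|)%N.
Proof.
rewrite -sum1_card big_mkcond sum_row_mx /=; apply: eq_bigr => i _.
by rewrite -sum1_card [RHS]big_mkcond.
Qed.

(* Every mixed-integer slice of [K'] contains translated and shrunk copies of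
   the [m ^ n] grid slices of [K] lying near it. *)
Lemma sum_slices_ge (A K K' : set 'rV[R]_(n + d)) : K `<=` C -> K' `<=` C ->
  (forall x x', A x -> C x' -> K ((1 - delta) *: x + delta *: x')) ->
  (forall x x', K x -> C x' -> K' ((1 - delta) *: x + delta *: x')) ->
  (1 - delta) ^+ (2 * (n + d)) * vol A <=
  \sum_(z : 'rV['I_(L + L)]_n) vol (slice K' (lattice_point z)).
Proof.
move=> KC K'C AK KK'.
have [m m0 hm] := nat_above (2 / (delta * r * (1 - delta))).
have m0' : 0 < m%:R :> R by rewrite ltr0n.
(* The mesh becomes [1 / m] after contraction by [1 - delta], so that exactly [m] columns per
   coordinate go to one integer. *)
pose h := (m%:R * (1 - delta))^-1; have h0 : 0 < h by rewrite invr_gt0 mulr_gt0.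
have hr : h <= delta * (r / 2).
  move: hm; rewrite ler_pdivrMr ?mulr_gt0// => hm.
  rewrite /h -div1r ler_pdivrMr ?mulr_gt0//; lra.
have h1 : (1 - delta) * h = m%:R^-1 by rewrite /h invfM mulrCA mulfV ?mulr1// gt_eqF.
have hE : h = (1 - delta)^-1 / m%:R by rewrite /h invfM mulrC.
pose B := (m * (L + L))%N.
have B0 : (0 < B)%N.
  by rewrite muln_gt0 m0 addn_gt0 orbb -(ltr_nat R); move: ML M0; lra.
have hB : h * B%:R = (L%:R + L%:R) / (1 - delta).
  by rewrite /B hE natrM natrD; field; rewrite !gt_eqF.
have dM : 0 <= M * delta by rewrite mulr_ge0 ?ltW.
(* This origin makes [z - (1 - delta) w], in each coordinate, equal to [delta b] plus a number in
   [[0, 1]]. Since [delta * rho >= 1], the point [v] below therefore lies in [box b rho], and so it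
   has a preimage in [C]. *)
pose o1 : 'rV[R]_n := \row_k ((- L%:R - delta * b 0 k - 1) / (1 - delta)).
pose o2 : 'rV[R]_d := const_mx (- M).
pose o := row_mx o1 o2.
have range x : C x -> box o (h * B%:R) x.
  move=> Cx k; have := CM k Cx; rewrite ler_norml hB /o -(splitK k) => /andP[x1 x2].
  move: ML x1 x2 => ML'; case: (fintype.split k) => l /=; rewrite ?row_mxEl ?row_mxEr !mxE => x1 x2.
    have := db l; rewrite ler_norml => /andP[b1 b2].
    have e1 : (- L%:R - delta * b 0 l - 1) / (1 - delta) <= - M.
      by rewrite ler_pdivrMr//; lra.
    have e2 : M <= (- L%:R - delta * b 0 l - 1) / (1 - delta) + (L%:R + L%:R) / (1 - delta).
      by rewrite -mulrDl ler_pdivlMr//; lra.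
    by apply/andP; split; lra.
  have e2 : 2 * M <= (L%:R + L%:R) / (1 - delta) by rewrite ler_pdivlMr//; lra.
  by apply/andP; split; lra.
pose X := [pred x : 'rV['I_B]_(n + d) | `[< box (grid_point o h (natv x)) h `<=` K >]].
have volX : (1 - delta) ^+ (n + d) * vol A <= h ^+ (n + d) * #|X|%:R.
  rewrite -(vol_affine (delta *: (c + const_mx (r / 2))) A onem0).
  apply: (@vol_le_cells _ _ nd0 o h B X) => // _ [x Ax <-].
  have [y _ yx] := @box_sub_cells R (n + d) o h B h0 B0 _ (range _ (KC _ (AK _ _ Ax Cq))).
  exists y => //; apply/asboolP; apply: (cell_sub_contraction boxC delta0 hr _ yx) => x'.
  exact: AK.
have key (i : 'rV['I_B]_n) : ((1 - delta) * h) ^+ d * #|[pred y | X (row_mx i y)]|%:R <=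
    vol (slice K' (lattice_point (map_mx divn_ord i))).
  set P := [pred y | _]; set z := lattice_point _; set w := grid_point o1 h (natv i).
  pose v := delta^-1 *: (z - (1 - delta) *: w).
  have vb : box b rho v.
    move=> k; have := @divn_real m (L + L) (i 0 k) m0; rewrite /= => /andP[f1 f2].
    have vE : delta * v 0 k = delta * b 0 k + 1 - ((i 0 k)%:R / m%:R - (divn_ord (i 0 k))%:R).
      by rewrite !mxE hE /=; field; rewrite !gt_eqF.
    rewrite -(ler_pM2l delta0) -[v 0 k <= _](ler_pM2l delta0) vE mulrDr.
    by move: rhodelta f1 f2 => ? ? ?; apply/andP; split; lra.
  have [x' Cx' ev] := projC vb.
  have cellsK y : cells o2 h P y -> K (row_mx w y).
    move=> [y0 /asboolP Py yy]; apply: Py; rewrite grid_point_row.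
    by apply/box_row; split=> // k; rewrite lexx lerDl ltW.
  have zE : z = (1 - delta) *: w + delta *: v.
    by rewrite /v scalerA mulfV ?gt_eqF// scale1r addrC subrK.
  rewrite exprMn -mulrA.
  apply: (@le_trans _ _ ((1 - delta) ^+ d * vol (cells o2 h P))).
    rewrite ler_wpM2l ?exprn_ge0 ?(ltW onem0)//.
    apply: (vol_ge_cells d0 h0 _ (@subset_refl _ _)).
    by apply: coord_boundedS (slice_bounded w bndC) => y /cellsK /KC.
  apply: (@vol_contract _ _ _ _ _ (delta *: rsubmx x')) => //.
    by apply: slice_bounded; exact: coord_boundedS bndC.
  move=> y /cellsK Ky; have := KK' _ _ Ky Cx'.
  by rewrite -[in X in K' X](hsubmxK x') ev !scale_row_mx add_row_mx -zE.
have sumkey : ((1 - delta) * h) ^+ d * #|X|%:R <=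
    (\sum_(z : 'rV['I_(L + L)]_n) vol (slice K' (lattice_point z))) *+ m ^ n.
  rewrite -(@sum_div_index m (L + L) n _ (fun z : 'rV['I_(L + L)]_n => vol (slice K' (lattice_point z)))) //.
  by rewrite card_row natr_sum mulr_sumr; apply: ler_sum => i _; exact: key.
have hn : ((1 - delta) * h) ^+ n * (m ^ n)%:R = 1.
  by rewrite natrX -exprMn h1 mulVf ?expr1n// gt_eqF.
rewrite mulSn mul1n exprD -mulrA.
apply: le_trans (ler_wpM2l (exprn_ge0 _ (ltW onem0)) volX) _.
rewrite mulrA -exprMn exprD -mulrA.
apply: le_trans (ler_wpM2l (exprn_ge0 _ _) sumkey) _; first by rewrite mulr_ge0 ?ltW.
by rewrite -[_ *+ _]mulr_natl mulrA hn mul1r.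
Qed.

Hypothesis segC : segment_closed C.

(** Here a lattice slice is carried to each of the [m ^ n] grid columns over its unit cell. A first
    contraction, towards a point over [box b rho], reaches the column; a second, towards the centre
    of [box c r], ensures that the grid cubes met lie in [C]. With [s = (1 - delta) ^+ 2], the
    slices shrink by [s ^+ d] and the bases of the columns of one cell have total volume
    [s ^+ n]. *)
Lemma sum_slices_le :
  (1 - delta) ^+ (2 * (n + d)) *
    (\sum_(z : 'rV['I_(L + L)]_n) vol (slice C (lattice_point z))) <= vol C.
Proof.
pose s := (1 - delta) ^+ 2.
have s0 : 0 < s by rewrite exprn_gt0.
have s2 : 1 / 2 <= s by rewrite /s expr2; move: delta0 delta1 => ? ?; nra.
have [m m0 hm] := nat_above (2 * s / (delta * r)).
have m0' : 0 < m%:R :> R by rewrite ltr0n.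
pose h := s / m%:R; have h0 : 0 < h by rewrite divr_gt0.
have hr : h <= delta * (r / 2).
  move: hm; rewrite ler_pdivrMr ?mulr_gt0// => hm.
  by rewrite /h ler_pdivrMr//; lra.
pose B := (m * (L + L))%N.
have B0 : (0 < B)%N.
  by rewrite muln_gt0 m0 addn_gt0 orbb -(ltr_nat R); move: ML M0; lra.
have hB : h * B%:R = s * (L%:R + L%:R).
  by rewrite /B /h natrM natrD; field; rewrite !gt_eqF.
pose q := c + const_mx (r / 2).
pose o1 : 'rV[R]_n := \row_k (- (s * L%:R) + (1 - delta) * delta * b 0 k + delta * lsubmx q 0 k).
pose o2 : 'rV[R]_d := const_mx (- M).
pose o := row_mx o1 o2.
pose X := [pred x : 'rV['I_B]_(n + d) | `[< box (grid_point o h (natv x)) h `<=` C >]].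
have volX : h ^+ (n + d) * #|X|%:R <= vol C.
  apply: (@vol_ge_cells _ _ nd0 o h B) => // y [x /asboolP xC yx]; exact: xC.
have key (i : 'rV['I_B]_n) : s ^+ d * vol (slice C (lattice_point (map_mx divn_ord i))) <=
    h ^+ d * #|[pred y | X (row_mx i y)]|%:R.
  set P := [pred y | _]; set z := lattice_point _; set w := grid_point o1 h (natv i).
  pose v : 'rV[R]_n := \row_k (b 0 k + (1 - delta) / delta * ((i 0 k)%:R / m%:R - (divn_ord (i 0 k))%:R)).
  have vb : box b rho v.
    move=> k; have := @divn_real m (L + L) (i 0 k) m0; rewrite /= => /andP[f1 f2].
    rewrite mxE lerDl lerD2l mulr_ge0 ?divr_ge0 ?(ltW onem0) ?(ltW delta0)//=.
    apply: (@le_trans _ _ ((1 - delta) / delta * 1)).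
      by rewrite ler_wpM2l ?divr_ge0 ?(ltW onem0) ?(ltW delta0).
    by rewrite mulr1 ler_pdivrMr// mulrC; move: rhodelta delta0 => ? ?; lra.
  have [x' Cx' ev] := projC vb.
  have wE : w = (1 - delta) *: ((1 - delta) *: z + delta *: v) + delta *: lsubmx q.
    apply/rowP => k; rewrite !mxE /h /s; field.
    by rewrite !gt_eqF.
  rewrite -(vol_affine ((1 - delta) *: (delta *: rsubmx x') + delta *: rsubmx q) _ s0).
  apply: (@vol_le_cells _ _ d0 o2 h B) => // _ [y Cy <-].
  set y' := (Y in cells _ _ _ Y).
  pose Pt := (1 - delta) *: row_mx z y + delta *: x'.
  have CPt : C Pt by apply: segC => //; rewrite (ltW delta0); move: delta1; lra.
  have yE : row_mx w y' = (1 - delta) *: Pt + delta *: q.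
    rewrite /Pt -[in RHS](hsubmxK x') ev -[in RHS](hsubmxK q) !(scale_row_mx, add_row_mx) -wE.
    congr row_mx; rewrite /y' scalerDr scalerA -expr2 -/s addrA //.
  have Cy' : C (row_mx w y').
    by rewrite yE; apply: segC => //; rewrite (ltW delta0); move: delta1; lra.
  have [|y0 _ yy0] := @box_sub_cells R d o2 h B h0 B0 y'.
    move=> k; have := CM (rshift n k) Cy'; rewrite row_mxEr ler_norml hB => /andP[y1 y2].
    have : 1 / 2 * (L%:R + L%:R) <= s * (L%:R + L%:R) by rewrite ler_wpM2r.
    by rewrite mxE; move: ML => ? ?; apply/andP; split; lra.
  exists y0 => //; apply/asboolP.
  apply: (cell_sub_contraction (x := Pt) boxC delta0 hr) => [x'' Cx''|].
    by apply: segC => //; rewrite (ltW delta0); move: delta1; lra.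
  rewrite -/q -yE grid_point_row; apply/box_row; split=> // k.
  by rewrite lexx lerDl ltW.
have sumkey : s ^+ d * (\sum_(z : 'rV['I_(L + L)]_n) vol (slice C (lattice_point z))) *+ m ^ n <=
    h ^+ d * #|X|%:R.
  rewrite -mulrnAr.
  rewrite -(@sum_div_index m (L + L) n _
    (fun z : 'rV['I_(L + L)]_n => vol (slice C (lattice_point z)))) //.
  by rewrite card_row natr_sum !mulr_sumr; apply: ler_sum => i _; exact: key.
have hn : h ^+ n * (m ^ n)%:R = s ^+ n.
  by rewrite natrX -exprMn /h divfK// gt_eqF.
apply: le_trans volX; rewrite exprM -/s exprD -mulrA -hn.
rewrite -mulrA mulr_natl exprD -mulrA ler_wpM2l// exprn_ge0// ltW//.
Qed.

End Slices.

(** * Normalization of the Hausdorff measure *)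
(** Half of the exponential decay absorbs the power. The majorant is, up to a constant, the density
    of the exponential law of rate 1/2, whose integral is known. *)
Lemma powR_expR_le (R : realType) (a : R) : 0 <= a ->
  exists2 K : R, 0 < K & forall t, 0 <= t -> t `^ a * expR (- t) <= K * expR (- (2^-1 * t)).
Proof.
move=> a0; have [m m0 am] := nat_above a.
have m0' : 0 < m%:R :> R by rewrite ltr0n.
have K0 : 0 < (2 * m%:R) ^+ m :> R by rewrite exprn_gt0// mulr_gt0.
exists ((2 * m%:R) ^+ m) => // t t0.
have -> : expR (- t) = expR (- (2^-1 * t)) * expR (- (2^-1 * t)).
  by rewrite -expRD; congr expR; lra.
rewrite mulrA ler_wpM2r ?expR_ge0// expRN ler_pdivrMr ?expR_gt0//.
apply: (@le_trans _ _ ((1 + t) `^ a)).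
  by apply: ge0_ler_powR; rewrite ?nnegrE ?addr_ge0// lerDr.
apply: (@le_trans _ _ ((1 + t) `^ m%:R)).
  by apply: ler_powR => //; rewrite lerDl.
rewrite powR_mulrn ?addr_ge0//.
have -> : expR (2^-1 * t) = expR (t / (2 * m%:R)) ^+ m.
  by rewrite -expRM_natl; congr expR; field; rewrite gt_eqF.
rewrite -exprMn; apply: lerXn2r; rewrite ?nnegrE.
- by rewrite addr_ge0.
- by rewrite mulr_ge0 ?expR_ge0// mulr_ge0.
apply: le_trans (_ : 2 * m%:R * (1 + t / (2 * m%:R)) <= _).
  have -> : 2 * m%:R * (1 + t / (2 * m%:R)) = 2 * m%:R + t by field; rewrite gt_eqF.
  by rewrite lerD2r; have : 1 <= m%:R :> R; [rewrite ler1n|lra].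
by rewrite ler_wpM2l ?expR_ge1Dx// mulr_ge0// ltW.
Qed.

(** [Gamma] is the [fine] of an extended integral, so its positivity also requires that the integral
    is finite. Positivity of the integral is read off on [[1, 2]]. *)
Lemma Gamma_gt0 (R : realType) (s : R) : 1 <= s -> 0 < Gamma s.
Proof.
move=> s1; pose g (t : R) := t `^ (s - 1) * expR (- t); pose f := EFin \o g.
have a0 : 0 <= s - 1 by rewrite subr_ge0.
have f0 t : (0 <= f t)%E by rewrite lee_fin mulr_ge0 ?powR_ge0 ?expR_ge0.
have mf (D : set R) : measurable D -> measurable_fun D (EFin \o g).
  move=> mD; apply/measurable_EFinP; apply: measurable_funM.
    by apply: measurable_funTS; exact: measurable_powR.
  apply: measurable_funTS; apply: measurableT_comp; first exact: measurable_expR.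
  exact: oppr_measurable.
rewrite /Gamma /Rintegral -/(f _); apply: fine_gt0; apply/andP; split.
  apply: (@lt_le_trans _ _ (\int[lebesgue_measure]_(t in `[1%R, 2%R]) (expR (- 2))%:E)%E).
    rewrite integral_cst//= lebesgue_measure_itv /= lte_fin ltr1n /= -EFinD -EFinM lte_fin.
    by rewrite mulr_gt0 ?expR_gt0//; lra.
  apply: (@le_trans _ _ (\int[lebesgue_measure]_(t in `[1%R, 2%R]) f t)%E).
    apply: ge0_le_integral => //.
    - exact: mf.
    - move=> t; rewrite /= in_itv /= => /andP[t1 t2]; rewrite lee_fin -[leLHS]mul1r.
      apply: ler_pM; rewrite ?expR_ge0//; last by rewrite ler_expR lerN2.
      apply: (@le_trans _ _ ((1 : R) `^ (s - 1))); first by rewrite powR1.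
      by apply: ge0_ler_powR => //; rewrite nnegrE; lra.
  apply: ge0_subset_integral => //; first exact: mf.
  by move=> t; rewrite /= !in_itv /= andbT => /andP[? _]; lra.
have [K K0 hK] := powR_expR_le a0.
apply: (@le_lt_trans _ _ (\int[lebesgue_measure]_(t in `]0%R, +oo[)
    ((K * 2)%:E * (exponential_pdf 2^-1 t)%:E))%E).
  apply: ge0_le_integral => //.
  - by move=> t _; exact: f0.
  - exact: mf.
  - by apply: measurable_funeM; apply/measurable_EFinP; apply: measurable_funTS;
      exact: measurable_exponential_pdf.
  - move=> t; rewrite /= in_itv /= andbT => t0.
    rewrite exponential_pdfE ?(ltW t0)// -EFinM lee_fin (le_trans (hK _ (ltW t0)))//.
    by rewrite mulrA mulfK// mulNr.
apply: (@le_lt_trans _ _ (\int[lebesgue_measure]_t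
    ((K * 2)%:E * (exponential_pdf 2^-1 t)%:E))%E).
  apply: ge0_subset_integral => //.
  - by apply: measurable_funeM; apply/measurable_EFinP; exact: measurable_exponential_pdf.
  - by move=> t _; rewrite -EFinM lee_fin mulr_ge0 ?exponential_pdf_ge0// mulr_ge0 ?ltW.
rewrite ge0_integralZl_EFin//.
- by rewrite integral_exponential_pdf ?invr_gt0// mule1 ltry.
- by move=> t _; rewrite lee_fin exponential_pdf_ge0.
- by apply/measurable_EFinP; exact: measurable_exponential_pdf.
- by rewrite mulr_ge0 ?ltW.
Qed.

(** * The center *)
Lemma coord_bounded_compact (R : realType) (p : nat) (C : set 'rV[R]_p) :
  compact C -> coord_bounded C.
Proof.
move=> cC; have [C0|/set0P C0] := eqVneq C set0; first by exists 0; rewrite C0.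
have bnd (i : 'I_p) : exists m, forall x, C x -> `|x 0 i| <= m.
  have ei x : dotv (delta_mx 0 i) x = x 0 i.
    rewrite /dotv (bigD1 i)//= mxE !eqxx mul1r big1 ?addr0// => j ji.
    by rewrite mxE (negPf ji) andbF mul0r.
  have [a _ amax] := dotv_max (delta_mx 0 i) cC C0.
  have [b _ bmax] := dotv_max (- delta_mx 0 i) cC C0.
  exists (`|a 0 i| + `|b 0 i|) => x Cx.
  have := amax x Cx; have := bmax x Cx; rewrite !dotvNl !ei lerN2 => h1 h2.
  have := ler_norm (a 0 i); have := lerNnormlW (lexx `|b 0 i|) => h3 h4.
  have := normr_ge0 (a 0 i); have := normr_ge0 (b 0 i) => h5 h6.
  by rewrite ler_norml; apply/andP; split; lra.
have [m hm] := fin_all_exists bnd.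
exists (\sum_i `|m i|) => x i Cx; rewrite (bigD1 i)//=.
apply: le_trans (hm i x Cx) _; apply: le_trans (ler_norm _) _.
by rewrite lerDl sumr_ge0.
Qed.

Section MixedIntegerSlices.
Context {R : realType} {n d : nat}.
Implicit Types (X : set 'rV[R]_(n + d)).

Lemma enorm_row_mx (x : 'rV[R]_n) (y : 'rV[R]_d) : enorm (row_mx x y) ^+ 2 = enorm x ^+ 2 + enorm y ^+ 2.
Proof.
rewrite /enorm !sqr_sqrtr ?dotv_ge0// /dotv big_split_ord /=.
by congr (_ + _); apply: eq_bigr => i _; rewrite ?row_mxEl ?row_mxEr.
Qed.

(** [row_mx z] is an isometric embedding with inverse [rsubmx], so both Lipschitz estimates hold
    with constant 1: the measure of a slice does not depend on the ambient space. *)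
Lemma prehausdorff_row_mx (r : R) (z : 'rV[R]_n) (A : set 'rV[R]_d) : 0 <= r ->
  prehausdorff r (row_mx z @` A) = prehausdorff r A.
Proof.
move=> r0.
have E (y y' : 'rV[R]_d) : enorm (row_mx z y - row_mx z y') = enorm (y - y').
  apply/eqP; rewrite -(@eqrXn2 _ 2) ?enorm_ge0//; apply/eqP.
  by rewrite opp_row_mx add_row_mx subrr enorm_row_mx enorm0 expr0n add0r.
apply/eqP; rewrite eq_le; apply/andP; split.
  have := @prehausdorff_lipschitz R d (n + d) r 1 A (row_mx z) r0 ltr01.
  rewrite powR1 mul1e; apply => x y _ _; rewrite mul1r.
  by rewrite E.
have := @prehausdorff_lipschitz R (n + d) d r 1 (row_mx z @` A) rsubmx r0 ltr01.
rewrite powR1 mul1e image_comp (_ : [set (rsubmx \o row_mx z) x | x in A] = A).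
  by apply => _ _ [x _ <-] [y _ <-]; rewrite mul1r !row_mxKr E.
apply/seteqP; split => [_ [x Ax <-]|x Ax] /=; first by rewrite row_mxKr.
by exists x => //=; rewrite row_mxKr.
Qed.

Lemma mixed_integer_slices X (M : R) (L : nat) :
  (forall x i, X x -> `|x 0 i| <= M) -> M < L%:R ->
  X `&` mixed_integer R n d = [set x | exists2 z : 'rV['I_(L + L)]_n, z \in index_enum 'rV['I_(L + L)]_n &
     (row_mx (lattice_point z) @` slice X (lattice_point z)) x].
Proof.
move=> XM ML; apply/seteqP; split => [x [Xx xint]|x [z _ [y Xy <-]]].
  have ex k : exists j : 'I_(L + L), lsubmx x 0 k = j%:R - L%:R.
    have := XM _ (lshift d k) Xx; rewrite (_ : x 0 (lshift d k) = lsubmx x 0 k); last by rewrite mxE.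
    rewrite ler_norml => /andP[x1 x2].
    have : lsubmx x 0 k + L%:R \is a Num.nat.
      by rewrite natrEint; apply/andP; split; [rewrite rpredD// intr_nat|lra].
    move=> /natrP[j hj]; have jL : (j < L + L)%N.
      by rewrite -(ltr_nat R) -hj natrD; lra.
    by exists (Ordinal jL); rewrite /= -hj addrK.
  have [f hf] := fin_all_exists ex.
  exists (\row_k f k); first by rewrite mem_index_enum.
  have -> : lattice_point (\row_k f k) = lsubmx x.
    by apply/rowP => k; rewrite [LHS]mxE (_ : (\row_k f k) 0 k = f k) ?hf//; rewrite mxE.
  by exists (rsubmx x); rewrite /slice /= hsubmxK.
split=> // k; rewrite row_mxKl mxE rpredB// intr_nat//.
Qed.

Hypothesis d0 : (0 < d)%N.

(** Slices over distinct lattice points are at distance at least 1, so the measure is additive over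
    them. *)
Lemma prehausdorff_mixed_integer X (M : R) (L : nat) :
  (forall x i, X x -> `|x 0 i| <= M) -> M < L%:R ->
  prehausdorff d%:R (X `&` mixed_integer R n d) =
  (fine (@unit_mass R d) * \sum_(z : 'rV['I_(L + L)]_n) vol (slice X (lattice_point z)))%:E.
Proof.
move=> XM ML.
have bX : coord_bounded X by exists M.
have sumE : (\sum_(z : 'rV['I_(L + L)]_n)
    prehausdorff d%:R (row_mx (lattice_point z) @` slice X (lattice_point z)) =
    (fine (@unit_mass R d) * \sum_(z : 'rV['I_(L + L)]_n) vol (slice X (lattice_point z)))%:E)%E.
  rewrite mulr_sumr -sumEFin; apply: eq_bigr => z _.
  by rewrite prehausdorff_row_mx// prehausdorffE//; exact: slice_bounded.
rewrite (mixed_integer_slices XM ML) -sumE; apply/eqP; rewrite eq_le; apply/andP; split.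
  by apply: subadditive_bigU; [exact: prehausdorff0|exact: prehausdorffU].
apply: (@prehausdorff_big_separated R _ _ d%:R 1) => //; first exact: index_enum_uniq.
move=> z z' _ _ _ _ zz' [y _ <-] [y' _ <-].
have [k zk] : exists k, z 0 k != z' 0 k.
  apply/existsP; move: zz'; apply: contraNT; rewrite negb_exists => /forallP h.
  by apply/eqP/rowP => i; apply/eqP; have := h i; rewrite negbK.
apply: le_trans (coord_le_enorm _ (lshift d k)).
rewrite opp_row_mx add_row_mx row_mxEl !mxE opprB addrA subrK.
have [lt|lt|/val_inj/eqP] := ltngtP (z 0 k) (z' 0 k); last by rewrite (negPf zk).
  have : (z 0 k)%:R + 1 <= (z' 0 k)%:R :> R by rewrite natr1 ler_nat.
  by move=> ?; rewrite ler0_norm; lra.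
have : (z' 0 k)%:R + 1 <= (z 0 k)%:R :> R by rewrite natr1 ler_nat.
by move=> ?; rewrite ger0_norm; lra.
Qed.

End MixedIntegerSlices.

(* A point of [C] with integral first coordinates is found by moving the
   approximate barycenter [g] a fraction [delta] towards a suitable point of [C]
   above the ball of radius [k]. *)
Lemma mixed_integer_center (R : realType) (n d : nat) (k : R) (C : set 'rV[R]_(n + d)) :
  (0 < n)%N -> (0 < d)%N -> 0 < k -> convex_body C ->
  (exists c : 'rV[R]_n, eball c k `<=` lsubmx @` C) ->
  let S := C `&` mixed_integer R n d in
  let delta := Num.sqrt n%:R / k in
  delta <= 1 / 4 -> 13 * ((n + d)%:R * delta) <= (expR 1)^-1 ->
  (0 < prehausdorff d%:R S < +oo)%E /\
  exists2 x : 'rV[R]_(n + d), S x &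
    forall u z : 'rV[R]_(n + d), u != 0 -> halfspace u z x ->
      (((expR 1)^-1 - 17 * ((n + d)%:R * delta))%:E * prehausdorff d%:R S <=
       prehausdorff d%:R (S `&` halfspace u z))%E.
Proof.
move=> n0 d0 k0 [cC convC [q Cq]] [b bC] S delta delta14 delta13.
have nd0 : (0 < n + d)%N by rewrite addn_gt0 n0.
have sn0 : 0 < Num.sqrt n%:R :> R by rewrite sqrtr_gt0 ltr0n.
have delta0 : 0 < delta by rewrite divr_gt0.
have segC := convex_set_segment convC.
have [M0' CM'] := coord_bounded_compact cC.
pose M := `|M0'| + 1.
have M0 : 0 < M by rewrite ltr_wpDl.
have CM x i : C x -> `|x 0 i| <= M.
  by move=> Cx; rewrite (le_trans (CM' x i Cx))// (le_trans (ler_norm _))// lerDl.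
have bndC : coord_bounded C by exists M.
have [r r0 [c boxC]] : exists2 r, 0 < r & exists c, box c r `<=` C.
  move: Cq => /nbhs_ballP[e /= e0 he]; exists (e / 2); first by rewrite divr_gt0.
  exists q => y yq; apply: he; split=> // i j; rewrite ord1 -ball_normE /=.
  have /andP[? ?] := yq j; rewrite ler0_norm; lra.
(* The cube of side [rho] with lower corner at the centre of the ball lies in the ball, and
   [delta * rho = 1]. *)
pose rho := k / Num.sqrt n%:R.
have rhodelta : 1 <= delta * rho.
  by rewrite /rho /delta mulrA divfK ?gt_eqF// divff// gt_eqF.
have projC : box b rho `<=` lsubmx @` C.
  move=> y yb; apply: bC; rewrite /eball /=.
  have -> : k = Num.sqrt n%:R * rho by rewrite /rho mulrC divfK// gt_eqF.
  apply: enorm_le_coord => [|i]; first by rewrite divr_ge0 ?ltW.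
  by have /andP[? ?] := yb i; rewrite !mxE ger0_norm; lra.
have [L _ ML] := nat_above (2 * M + 1).
have MltL : M < L%:R by lra.
have volC := vol_body_gt0 nd0 bndC r0 boxC.
have Kd := @fine_unit_mass_gt0 R d d0.
pose N : R := (n + d)%:R.
have Nd0 : 0 < N * delta by rewrite mulr_gt0// ltr0n.
have [g Cg hg] := grunbaum_approx nd0 segC bndC r0 boxC Nd0.
pose Sig (X : set 'rV[R]_(n + d)) := \sum_(z : 'rV['I_(L + L)]_n) vol (slice X (lattice_point z)).
have SE X : X `<=` C -> prehausdorff d%:R (X `&` mixed_integer R n d) = (fine (@unit_mass R d) * Sig X)%:E.
  by move=> XC; apply: (prehausdorff_mixed_integer d0 _ MltL) => x i /XC; exact: CM.
have onem : 0 <= 1 - delta by lra.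
have dbnd : 0 <= delta <= 1 by rewrite ltW//=; lra.
pose T := (1 - delta) ^+ (2 * (n + d)).
have T0 : 0 <= T by rewrite exprn_ge0.
have T1 : T <= 1 by rewrite exprn_ile1// gerBl ltW.
have TN : 1 - 2 * (N * delta) <= T.
  by have := onem_expr_ge (2 * (n + d)) dbnd; rewrite natrM mulrA.
have ge A K K' := @sum_slices_ge R n d C c b r rho delta M L n0 d0 r0 boxC M0 CM ML projC
  delta0 delta14 rhodelta A K K'.
have le : T * Sig C <= vol C.
  exact: (@sum_slices_le R n d C c b r rho delta M L n0 d0 r0 boxC M0 CM ML projC
    delta0 delta14 rhodelta segC).
have SigC : 0 < Sig C.
  apply: lt_le_trans (ge C C C _ _ _ _) => //; last first.
  - by move=> x x' Cx Cx'; exact: segC.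
  - by move=> x x' Cx Cx'; exact: segC.
  - by rewrite mulr_gt0// exprn_gt0//; lra.
rewrite SE//; split; first by rewrite lte_fin mulr_gt0//= ltry.
(* Moving [g] towards a point over [b] gives the first coordinates [t]. Replacing [b] by [v] raises
   each of them to the next integer [floor + 1], by at most [1 = delta * rho], so [v] stays in
   [box b rho]. *)
pose t (i : 'I_n) := (1 - delta) * lsubmx g 0 i + delta * b 0 i.
pose v : 'rV[R]_n := \row_i (((Num.floor (t i))%:~R + 1 - (1 - delta) * lsubmx g 0 i) / delta).
have vb : box b rho v.
  move=> i; rewrite mxE ler_pdivlMr// ler_pdivrMr//.
  have h1 := floor_le (t i); have h2 : t i < (Num.floor (t i))%:~R + 1.
    by rewrite -[1]/(1%:~R) -intrD -floor_lt_int ltzD1.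
  rewrite [b 0 i * delta]mulrC (_ : (b 0 i + rho) * delta = delta * b 0 i + delta * rho); last by ring.
  move: h1 h2; rewrite /t => h1 h2.
  by apply/andP; split; lra.
have [x' Cx' ev] := projC v vb.
pose x := (1 - delta) *: g + delta *: x'.
have Cx : C x by exact: segC.
exists x.
  split=> // i; rewrite !mxE.
  have -> : x' 0 (lshift d i) = v 0 i by rewrite -ev mxE.
  rewrite mxE mulrCA mulfV ?gt_eqF// mulr1 mxE addrC subrK.
  by apply: rpredD; [exact: intr_int|exact: rpred1].
move=> u z u0; rewrite /halfspace /= dotvBr subr_ge0 => zx.
have C0 : C !=set0 by exists g.
have [bm Cb ub] := dotv_max u cC C0.
have [am Ca ua'] := dotv_max (- u) cC C0.
have ua y : C y -> dotv u am <= dotv u y by move=> /ua'; rewrite !dotvNl lerN2.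
set w := dotv u bm - dotv u am.
have w0 : 0 < w by exact: (width_gt0 r0 boxC).
have osc y y' : C y -> C y' -> dotv u y - dotv u y' <= w by move=> Cy Cy'; exact: (lerB (ub _ Cy) (ua _ Cy')).
set tz := dotv u z in zx.
have capE : S `&` halfspace u z = cap C u tz `&` mixed_integer R n d.
  by apply/seteqP; split => y [[Cy my]]; rewrite /halfspace /= ?dotvBr ?subr_ge0.
have step s y y' : cap C u (s + delta * w) y -> C y' -> cap C u s ((1 - delta) *: y + delta *: y').
  move=> [Cy sy] Cy'; split; first exact: segC.
  have := ler_wpM2l (ltW delta0) (osc _ _ Cy Cy').
  by rewrite dotvDr !dotvZr; lra.
have := ge (cap C u (tz + delta * w + delta * w)) (cap C u (tz + delta * w)) (cap C u tz)
  (@cap_sub _ _ _ _ _) (@cap_sub _ _ _ _ _) (step _) (step _).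
rewrite -/T -/(Sig _) => hge.
have hx : tz <= dotv u g + delta * w.
  apply: le_trans zx _; rewrite dotvDr !dotvZr.
  by have := ler_wpM2l (ltW delta0) (osc _ _ Cx' Cg); lra.
(* The 13 is 1 for the loss [N * delta] at [g] plus [4 * 3] for a slab of relative width
   [3 * delta]: one [delta] for the passage from [g] to [x], two for the two contractions of
   [sum_slices_ge]. *)
have hcap : ((expR 1)^-1 - 13 * (N * delta)) * vol C <= vol (cap C u (tz + delta * w + delta * w)).
  apply: (@le_trans _ _ (vol (cap C u (dotv u g + 3 * delta * w)))); last first.
    by apply: vol_cap_anti => //; lra.
  have := hg u am bm Ca Cb ua ub u0.
  have d3 : 0 < 3 * delta by rewrite mulr_gt0.
  have := vol_cap_slab nd0 segC bndC r0 boxC (dotv u g) Ca Cb ua ub u0 d3.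
  by rewrite -/w -/N; lra.
rewrite capE SE; last exact: cap_sub.
rewrite -EFinM lee_fin mulrCA ler_pM2l//.
apply: le_trans hge; apply: le_trans (ler_wpM2l T0 hcap).
have e1 : (expR 1)^-1 <= 1 :> R by rewrite invf_le1 ?expR_gt0// -expR0 ler_expR.
set E := (expR 1)^-1 in delta13 e1 *; set D := N * delta in Nd0 TN *.
have E13 : 0 <= E - 13 * D by rewrite subr_ge0.
apply: (@le_trans _ _ (T * ((E - 13 * D) * (T * Sig C)))); last first.
  by rewrite ler_wpM2l// ler_wpM2l.
(* The factor [T] enters once for the slices of the cap and once for those of [C];
   [T ^+ 2 >= 1 - 4 * D] raises the loss from 13 to 17. *)
have -> : T * ((E - 13 * D) * (T * Sig C)) = T ^+ 2 * (E - 13 * D) * Sig C by ring.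
rewrite ler_wpM2r ?(ltW SigC)//.
have T4 : 1 - 4 * D <= T ^+ 2.
  have := sqr_ge0 (1 - T); rewrite (_ : (1 - T) ^+ 2 = 1 - 2 * T + T ^+ 2); last by ring.
  by move: TN; lra.
have := ler_wpM2r E13 T4.
have : 0 <= D * (1 - E + 13 * D) by rewrite mulr_ge0 ?(ltW Nd0)//; lra.
lra.
Qed.

(** * Hausdorff dimension and numerical constants *)

Lemma hausdorff_factor_gt0 (R : realType) (r : R) : 0 <= r -> 0 < hausdorff_factor r.
Proof.
move=> r0; rewrite /hausdorff_factor divr_gt0 ?powR_gt0 ?pi_gt0// mulr_gt0 ?powR_gt0//.
by apply: Gamma_gt0; rewrite lerDr divr_ge0.
Qed.

Lemma hausdorffE (R : realType) (p : nat) (r : R) (A : set 'rV[R]_p) :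
  hausdorff r A = ((hausdorff_factor r)%:E * prehausdorff r A)%E.
Proof. by []. Qed.

(** Finite measure in dimension [r] makes every larger dimension null; a null dimension [s < r]
    would make dimension [r] null too, against positivity. *)
Lemma hausdorff_dim_eq (R : realType) (p : nat) (r : R) (A : set 'rV[R]_p) : 0 <= r ->
  (0 < prehausdorff r A < +oo)%E -> hausdorff_dim A = r.
Proof.
move=> r0 /andP[Ap Af].
have above s : r < s -> [set s | 0 <= s /\ hausdorff s A = 0%E] s.
  move=> rs; split; first by rewrite ltW// (le_lt_trans r0).
  by rewrite hausdorffE (prehausdorff_dim_lt r0 rs Af) mule0.
have below : lbound [set s | 0 <= s /\ hausdorff s A = 0%E] r.
  move=> s [s0 /eqP]; rewrite hausdorffE mule_eq0 eqe gt_eqF ?hausdorff_factor_gt0//= => /eqP A0.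
  rewrite leNgt; apply/negP => sr; move: Ap.
  by rewrite (prehausdorff_dim_lt s0 sr) ?ltxx// A0 ltry.
apply/eqP; rewrite eq_le; apply/andP; split; last first.
  by apply: lb_le_inf => //; exists (r + 1); apply: above; rewrite ltrDl.
apply/ler_addgt0Pr => e e0; apply: ge_inf; first by exists r.
by apply: above; rewrite ltrDl.
Qed.

Lemma bernoulli_ge (R : realType) (m : nat) (x : R) : 0 <= x -> 1 + m%:R * x <= (1 + x) ^+ m.
Proof.
move=> x0; elim: m => [|m IH]; first by rewrite mul0r addr0 expr0.
have h : 0 <= m%:R * x ^+ 2 by rewrite mulr_ge0 ?sqr_ge0.
rewrite exprS; apply: (@le_trans _ _ ((1 + x) * (1 + m%:R * x))).
  by rewrite -natr1 mulrDl mulrDr !mul1r mulr1; move: h; rewrite expr2; lra.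
by rewrite ler_wpM2l// addr_ge0.
Qed.

Lemma ratio_expr_le_half (R : realType) (d : nat) : (0 < d)%N ->
  (d%:R / (d%:R + 1)) ^+ d <= 1 / 2 :> R.
Proof.
move=> d0; have d0' : 0 < d%:R :> R by rewrite ltr0n.
have -> : d%:R / (d%:R + 1) = (1 + d%:R^-1)^-1 :> R.
  by field; rewrite !gt_eqF// addr_gt0.
have := @bernoulli_ge R d d%:R^-1; rewrite invr_ge0 ltW// mulfV ?gt_eqF// => /(_ isT) h.
rewrite exprVn div1r lef_pV2 ?posrE ?exprn_gt0 ?addr_gt0 ?invr_gt0//.
Qed.

(** The cube of [exp(-1/3) >= 2/3]. That 8/27 exceeds 1/4 leaves the room needed for the Oertel
    radius. *)
Lemma inv_expR1_ge (R : realType) : 8 / 27 <= (expR 1 : R)^-1.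
Proof.
rewrite -expRN (_ : -1 = 3%:R * (- (1 / 3))); last by lra.
rewrite expRM_natl; apply: (@le_trans _ _ ((1 - 1 / 3) ^+ 3)); first by rewrite !exprS expr0; lra.
by apply: lerXn2r; rewrite ?nnegrE ?expR_ge0//; [lra|exact: expR_ge1Dx].
Qed.

Theorem theorem4p5 (R : realType) :
  (forall (n d : nat) (k : R) (C : set 'rV[R]_(n + d)),
     (0 < n)%N -> (0 < d)%N -> 0 < k ->
     convex_body C ->
     (exists c : 'rV[R]_n, eball c k `<=` lsubmx @` C) ->
     let S := C `&` mixed_integer R n d in
     S !=set0 ->
     exists2 x : 'rV[R]_(n + d), S x &
       forall u z : 'rV[R]_(n + d), u != 0 -> halfspace u z x ->
         ((((expR 1)^-1 - 32 * (d%:R * n%:R `^ (3 / 4) / k `^ (1 / 2)))%:E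
             * hausdorff d%:R S)
          <= hausdorff d%:R (S `&` halfspace u z))%E)
  /\
  (exists2 alpha : R, 0 < alpha &
   forall (n d : nat) (k : R) (C : set 'rV[R]_(n + d)),
     (0 < n)%N -> (0 < d)%N -> 0 < k ->
     convex_body C ->
     (exists c : 'rV[R]_n, eball c k `<=` lsubmx @` C) ->
     let S := C `&` mixed_integer R n d in
     S !=set0 ->
     alpha * d%:R ^+ 2 * n%:R `^ (3 / 2) <= k ->
     ((1 / 2 ^+ n * (d%:R / (d%:R + 1)) ^+ d)%:E <= oertel_radius S)%E).
Proof.
have e1 : (expR 1)^-1 <= 1 :> R by rewrite invf_le1 ?expR_gt0// -expR0 ler_expR.
have e0 : 0 < (expR 1)^-1 :> R by rewrite invr_gt0 expR_gt0.
have nd (n d : nat) (k : R) : (0 < n)%N -> (0 < d)%N -> 0 < k ->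
    Num.sqrt n%:R / k <= (n + d)%:R * (Num.sqrt n%:R / k) <=
      2 * (d%:R ^+ 2 * (n%:R * (Num.sqrt n%:R / k))).
  move=> n0 d0 k0; set delta := Num.sqrt n%:R / k.
  have delta0 : 0 <= delta by rewrite divr_ge0 ?sqrtr_ge0 ?ltW.
  apply/andP; split; first by rewrite ler_peMl// ler1n addn_gt0 n0.
  have le1 : (n + d)%:R <= 2 * (d%:R ^+ 2 * n%:R) :> R.
    by rewrite -natrX -!natrM ler_nat; nia.
  have := ler_wpM2r delta0 le1; rewrite -(mulrA 2) -(mulrA (_ ^+ 2)).
  by [].
split.
  move=> n d k C n0 d0 k0 bodyC ballC S S0.
  set s := d%:R * n%:R `^ (3 / 4) / k `^ (1 / 2).
  have f0 := @hausdorff_factor_gt0 R d%:R (ler0n _ _).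
  have s0 : 0 <= s by rewrite divr_ge0 ?powR_ge0// mulr_ge0 ?powR_ge0.
  (* When the coefficient is not positive, every point of [S] will do. *)
  have [coef|coef] := leP ((expR 1)^-1 - 32 * s) 0.
    case: S0 => x Sx; exists x => // u z _ _.
    apply: (@le_trans _ _ 0%E).
      by rewrite mule_le0_ge0 ?lee_fin// hausdorffE mule_ge0 ?lee_fin ?(ltW f0)// prehausdorff_ge0.
    by rewrite hausdorffE mule_ge0 ?lee_fin ?(ltW f0)// prehausdorff_ge0.
  set delta := Num.sqrt n%:R / k.
  have sE : s ^+ 2 = d%:R ^+ 2 * (n%:R * delta).
    have n0' : 0 < n%:R :> R by rewrite ltr0n.
    have pk : (k `^ (1 / 2)) ^+ 2 = k by rewrite div1r powR12_sqrt ?(ltW k0)// sqr_sqrtr// ltW.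
    have pn : (n%:R `^ (3 / 4)) ^+ 2 = n%:R * Num.sqrt n%:R :> R.
      rewrite expr2 -powRD; last by apply/implyP => _; rewrite gt_eqF.
      rewrite (_ : 3 / 4 + 3 / 4 = 1 + 2^-1); last by lra.
      rewrite powRD; last by apply/implyP => _; rewrite gt_eqF.
      by rewrite powRr1 ?ler0n// powR12_sqrt.
    by rewrite /s expr_div_n exprMn pk pn /delta !mulrA.
  have /andP[h1 h2] := nd n d k n0 d0 k0; rewrite -/delta -sE in h1 h2.
  (* From [32 * s < (expR 1)^-1 <= 1]. The quadratic loss [34 * s ^+ 2] is then at most
     [34 / 32 * s]. *)
  have s32 : s <= 1 / 32 by lra.
  have ss : s ^+ 2 <= s * (1 / 32) by rewrite expr2 ler_wpM2l.
  have d14 : delta <= 1 / 4 by lra.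
  have d13 : 13 * ((n + d)%:R * delta) <= (expR 1)^-1 by lra.
  have [_ [x Sx hx]] := mixed_integer_center n0 d0 k0 bodyC ballC d14 d13.
  exists x => // u z u0 zx; rewrite !hausdorffE muleCA.
  apply: lee_wpmul2l; first by rewrite lee_fin ltW.
  apply: le_trans (hx u z u0 zx).
  apply: lee_wpmul2r; first exact: prehausdorff_ge0.
  by rewrite lee_fin -/delta; lra.
(* The threshold on [k] at which the quantity [s] of the first part is at most 1/32. *)
exists (32 * 32); first by rewrite mulr_gt0.
move=> n d k C n0 d0 k0 bodyC ballC S S0 hk.
set delta := Num.sqrt n%:R / k.
have n0' : 0 < n%:R :> R by rewrite ltr0n.
have small : 32 * 32 * (d%:R ^+ 2 * (n%:R * delta)) <= 1.
  rewrite /delta !mulrA ler_pdivrMr// mul1r; apply: le_trans hk.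
  rewrite (_ : 3 / 2 = 1 + 2^-1); last by lra.
  rewrite powRD; last by apply/implyP => _; rewrite gt_eqF.
  by rewrite powRr1 ?ler0n// powR12_sqrt// !mulrA.
have /andP[h1 h2] := nd n d k n0 d0 k0; rewrite -/delta in h1 h2.
have e827 := @inv_expR1_ge R.
have d14 : delta <= 1 / 4 by lra.
have d13 : 13 * ((n + d)%:R * delta) <= (expR 1)^-1 by lra.
have [Sfin [x Sx hx]] := mixed_integer_center n0 d0 k0 bodyC ballC d14 d13.
have dimS := hausdorff_dim_eq (ler0n R d) Sfin.
rewrite /oertel_radius dimS; apply: le_ereal_sup_tmp.
exists (ereal_inf [set (hausdorff d%:R (halfspace u x `&` S) / hausdorff d%:R S)%E | u in [set u | u != 0]]).
  by exists x; [exact: Sx|].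
apply: le_ereal_inf_tmp => _ [u u0 <-].
have xx : halfspace u x x by rewrite /halfspace /= subrr dotv0r.
have := hx u x u0 xx; rewrite -/S (setIC S).
have [f0 [a aE a0]] : 0 < hausdorff_factor (d%:R : R) /\
    exists2 a, prehausdorff d%:R S = a%:E & 0 < a.
  split; first exact: hausdorff_factor_gt0.
  case/andP: Sfin; rewrite -/S; case: (prehausdorff _ S) => [a| |]// a0 _.
  by exists a => //; rewrite -lte_fin.
have fa0 : 0 < hausdorff_factor (d%:R : R) * a by exact: mulr_gt0.
rewrite !hausdorffE aE -EFinM inver (gt_eqF fa0) => hle; rewrite lee_pdivlMr//.
rewrite -EFinM mulrCA EFinM; apply: lee_wpmul2l; first by rewrite lee_fin ltW.
apply: le_trans hle; rewrite lee_fin ler_wpM2r ?(ltW a0)//.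
(* For [n, d >= 1] the target is at most 1/4, whereas the bound obtained is at least
   [8 / 27 - 34 / 1024 > 1 / 4]. *)
apply: (@le_trans _ _ (1 / 2 * (1 / 2))).
  apply: ler_pM; rewrite ?divr_ge0 ?exprn_ge0 ?divr_ge0 ?addr_ge0//; last exact: ratio_expr_le_half.
  rewrite ler_pM2l// lef_pV2 ?posrE ?exprn_gt0// -[leLHS]expr1 ler_weXn2l//.
  by rewrite ler1n.
by rewrite -/delta; lra.
Qed.
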